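(* Given a second-order channel model $\{(m_S,v_S^2): S\subseteq\{1,\dots,N\}\}$, a second-order delivery model $\{(\mu_i,\sigma_i^2): 1\le i\le N\}$ is in the second-order capacity region if $$\sum_{i\in S}\mu_i< m_S\quad\text{for all nonempty } S\subsetneq\{1,\dots,N\},$$ $$\sum_{i=1}^N\mu_i=m_{\{1,2,\dots,N\}},$$ $$\sum_{i=1}^N\sqrt{\sigma_i^2}\ \ge\ \sqrt{v_{\{1,2,\dots,N\}}^2},$$ $$\mu_i\ge 0,\ \sigma_i^2>0\quad\text{for all } i.$$
   Context: An access point (AP) serves $N$ clients $1,\dots,N$ in slotted time $t=1,2,3,\dots$. Let $X_i(t)\in\{0,1\}$ indicate that the channel of client $i$ is ON at time $t$. The channels are governed by Markov processes: the vector $(X_1(t),\dots,X_N(t))$ is a function of the state of an irreducible, positive-recurrent, finite-state Markov chain whose evolution is not affected by scheduling decisions. For $S\subseteq\{1,\dots,N\}$, $X_S(t):=\max\{X_i(t): i\in S\}$ (with $X_\emptyset\equiv 0$). The mean is $m_S:=\lim_{T\to\infty}\frac1T\sum_{t=1}^TX_S(t)$ (almost sure limit, a constant), and the temporal variance is $v_S^2:=E\big[\big(\lim_{T\to\infty}\frac{\sum_{t=1}^TX_S(t)-Tm_S}{\sqrt T}\big)^2\big]$, where the limit is in distribution (it exists and is Gaussian, possibly degenerate), i.e. $v_S^2$ is the second moment of the limiting law. The collection $\{(m_S,v_S^2)\}$ is the second-order channel model. Scheduling policy: in each slot $t$ in which at least one client has an ON channel, the AP, knowing the current channel states and the past, selects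 exactly one client with an ON channel and transmits a packet to it, which that client receives; if no channel is ON nothing is transmitted. Let $Z_i(t)\in\{0,1\}$ indicate that client $i$ receives a packet at time $t$. Second-order capacity region: the set of all $\{(\mu_i,\sigma_i^2): 1\le i\le N\}$ for which there exists a scheduling policy under which, for every $i$, $\lim_{T\to\infty}\frac1T\sum_{t=1}^TZ_i(t)=\mu_i$ (almost surely) and $E\big[\big(\lim_{T\to\infty}\frac{\sum_{t=1}^TZ_i(t)-T\mu_i}{\sqrt T}\big)^2\big]\le\sigma_i^2$, where the limit is understood in distribution (and exists), so the left side is the second moment of the limiting law. *)

(* Defs.v *)
(* Slots are indexed from 0: index t stands for slot t + 1,
   so that \sum_(t < T) is the sum over the first T slots. Client i of 1..N is
   an element of 'I_N. *)
From HB Require Import structures.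
From mathcomp Require Import all_boot all_order all_algebra.
From mathcomp Require Import all_classical all_reals all_analysis.
Import Order.TTheory GRing.Theory Num.Theory.
Import numFieldNormedType.Exports.

Set Implicit Arguments.
Unset Strict Implicit.
Unset Printing Implicit Defensive.

Local Open Scope classical_set_scope.
Local Open Scope ring_scope.

Definition is_pmf (R : realType) (F : finType) (q : F -> R) : Prop :=
  (forall x, 0 <= q x) /\ \sum_x q x = 1.

Fixpoint nstep (R : realType) (E : finType) (p : E -> E -> R) (n : nat)
    (x y : E) : R :=
  if n is n'.+1 then \sum_z p x z * nstep p n' z y else (x == y)%:R.

(* first_passage p n x y is the probability, starting from x, that the first
   visit to y at a time >= 1 occurs at time n.+1. *)
Fixpoint first_passage (R : realType) (E : finType) (p : E -> E -> R) (n : nat)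
    (x y : E) : R :=
  if n is n'.+1 then \sum_(z | z != y) p x z * first_passage p n' z y
  else p x y.

Definition irreducible_chain (R : realType) (E : finType) (p : E -> E -> R) :=
  forall x y, exists n, 0 < nstep p n x y.

(* Return to x is almost sure, with finite mean return time. *)
Definition positive_recurrent (R : realType) (E : finType) (p : E -> E -> R) :=
  forall x,
    (\sum_(0 <= n <oo) (first_passage p n x x)%:E = 1)%E /\
    (\sum_(0 <= n <oo) (n.+1%:R * first_passage p n x x)%:E < +oo)%E.

Definition markov_chain (R : realType) (E : finType) (init : E -> R)
    (p : E -> E -> R) (d : measure_display) (T : measurableType d)
    (P : probability T R) (Y : nat -> T -> E) : Prop :=
  (forall t x, measurable (Y t @^-1` [set x])) /\
  (forall (n : nat) (y : nat -> E),
     P [set w | forall t, (t <= n)%N -> Y t w = y t] =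
     (init (y 0%N) * \prod_(t < n) p (y t) (y t.+1))%:E).

Definition chan_state (N : nat) := {ffun 'I_N -> bool}.

(* X_S as a function of the channel vector; the maximum over the empty set
   is 0. *)
Definition chan_max (N : nat) (S : {set 'I_N}) (x : chan_state N) : nat :=
  (\max_(i in S) x i)%N.

(* Possibly randomized, history-dependent policies: pol h x a is the
   probability of taking decision a when the current channel vector is x and
   h lists the past (channel vector, decision) pairs, oldest first. The
   decision Some i is a transmission to client i, None is an idle slot. *)
Definition policy (R : realType) (N : nat) :=
  seq (chan_state N * option 'I_N) -> chan_state N -> option 'I_N -> R.

Definition is_policy (R : realType) (N : nat) (pol : policy R N) : Prop :=
  forall h x,
    [/\ is_pmf (pol h x),
        forall i, ~~ x i -> pol h x (Some i) = 0
      & (exists i, x i) -> pol h x None = 0].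

(* The state process Y and the decision process A have the joint law obtained
   by running pol on the chain. The factor p (y t) (y t.+1) depends on the past
   through y t only: scheduling does not affect the evolution of the chain. *)
Definition runs_policy (R : realType) (N : nat) (E : finType) (init : E -> R)
    (p : E -> E -> R) (chan : E -> chan_state N) (pol : policy R N)
    (d : measure_display) (T : measurableType d) (P : probability T R)
    (Y : nat -> T -> E) (A : nat -> T -> option 'I_N) : Prop :=
  [/\ forall t x, measurable (Y t @^-1` [set x]),
      forall t a, measurable (A t @^-1` [set a])
    & forall (n : nat) (y : nat -> E) (a : nat -> option 'I_N),
        P [set w | forall t, (t <= n)%N -> Y t w = y t /\ A t w = a t] =
        (init (y 0%N) * \prod_(t < n) p (y t) (y t.+1) *
         \prod_(t < n.+1)
           pol [seq (chan (y s), a s) | s <- iota 0 t] (chan (y t)) (a t))%:E].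

(* Almost sure long-run average of U. *)
Definition has_mean (R : realType) (d : measure_display) (T : measurableType d)
    (P : probability T R) (U : nat -> T -> nat) (m : R) : Prop :=
  {ae P, forall w,
    (\sum_(t < n) (U t w)%:R) / n%:R @[n --> \oo] --> m}.

(* Convergence of the distribution functions at every continuity point of the
   limiting one. *)
Definition cvg_in_law (R : realType) (d : measure_display)
    (T : measurableType d) (P : probability T R) (W : nat -> T -> R)
    (L : probability (measurableTypeR R) R) : Prop :=
  forall x : R, {for x, continuous (fun y : R => L [set z | z <= y])} ->
    P [set w | W n w <= x] @[n --> \oo] --> L [set z | z <= x].

Definition scaled_deviation (R : realType) (T : Type) (U : nat -> T -> nat)
    (m : R) (n : nat) (w : T) : R :=
  (\sum_(t < n) (U t w)%:R - n%:R * m) / Num.sqrt n%:R.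

(* The scaled deviations of U from m converge in distribution, and the second
   moment of the limiting law is v. *)
Definition has_limit_second_moment (R : realType) (d : measure_display)
    (T : measurableType d) (P : probability T R) (U : nat -> T -> nat) (m : R)
    (v : \bar R) : Prop :=
  exists L : probability (measurableTypeR R) R,
    cvg_in_law P (scaled_deviation U m) L /\
    (\int[L]_x (x ^+ 2)%:E = v)%E.

Definition second_order_channel_model (R : realType) (N : nat) (E : finType)
    (chan : E -> chan_state N) (d : measure_display) (T : measurableType d)
    (P : probability T R) (Y : nat -> T -> E) (m v2 : {set 'I_N} -> R) : Prop :=
  forall S : {set 'I_N},
    has_mean P (fun t w => chan_max S (chan (Y t w))) (m S) /\
    has_limit_second_moment P (fun t w => chan_max S (chan (Y t w))) (m S)
      (v2 S)%:E.

Definition delivery (N : nat) (T : Type) (A : nat -> T -> option 'I_N)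
    (i : 'I_N) (t : nat) (w : T) : nat := (A t w == Some i : bool).

(* The limits below are determined by the joint law of (Y, A), hence by the
   policy, so the choice of the probability space carrying it is immaterial. *)
Definition in_capacity_region (R : realType) (N : nat) (E : finType)
    (init : E -> R) (p : E -> E -> R) (chan : E -> chan_state N)
    (mu sigma2 : 'I_N -> R) : Prop :=
  exists pol : policy R N, is_policy pol /\
  exists (d : measure_display) (T : measurableType d) (P : probability T R)
    (Y : nat -> T -> E) (A : nat -> T -> option 'I_N),
    runs_policy init p chan pol P Y A /\
    forall i : 'I_N,
      has_mean P (delivery A i) (mu i) /\
      exists2 s : \bar R,
        has_limit_second_moment P (delivery A i) (mu i) s &
        (s <= (sigma2 i)%:E)%E.

(* Main.v *)
Require Import Defs.
From HB Require Import structures.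
From mathcomp Require Import all_boot all_order all_algebra.
From mathcomp Require Import all_classical all_reals all_analysis.
From mathcomp Require Import measurable_realfun lra ring zify.
Import Order.TTheory GRing.Theory Num.Theory.
Import numFieldNormedType.Exports.

Local Open Scope ring_scope.

(* Let c_i be the square root of sigma2_i and let D_i(t) = t mu_i - #(deliveries
   to i) be the deficit of client i. The policy serves the ON client with the
   largest D_i / c_i, a deterministic function of the past, so it runs on the
   given probability space. Put C = sum_i c_i, D = sum_i D_i (which depends on
   the channels only) and u_i = D_i / c_i - D / C.

   Collapse: V = sum_i c_i u_i^2 is quadratic in the deviation of the deficits
   from the ray spanned by c. Serving the largest u_i collects in each slot the
   sum over the upper level sets S of u of (gap of u below S) * X_S, so the
   strict inequalities mu(S) < m_S give V a drift -const * sqrt V over a block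
   long enough for the averages of every X_S to be close to m_S from each
   starting state. Hence V^2 has bounded drift, E V^2(t) = O(t), and therefore
   u_i / sqrt t -> 0 in probability and, by Borel-Cantelli, u_i / t -> 0 a.s.

   Then the deviation of client i is c_i / C times that of X_{1..N}, up to
   o(sqrt t), and its limiting second moment is (c_i / C)^2 v^2 <= c_i^2. *)

(** * Conditional expectations along the chain *)

Section PathExpectation.
Set Implicit Arguments.
Unset Strict Implicit.
Variables (R : realType) (E : finType) (init : E -> R) (p : E -> E -> R).
Hypothesis init_pmf : is_pmf init.
Hypothesis p_pmf : forall x, is_pmf (p x).

(** Trajectories are listed oldest first. Using [init] after the empty one makes [path_ev n g [::]]
    the unconditional expectation over the first [n] slots. *)
Definition next_law (h : seq E) : E -> R :=
  if h is x :: s then p (last x s) else init.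

Definition path_step (g : seq E -> R) (h : seq E) : R :=
  \sum_z next_law h z * g (rcons h z).

(* [path_ev n g h] is the conditional expectation of [g] applied to the
   trajectory [n] slots later, given that the trajectory so far is [h]. *)
Definition path_ev (n : nat) (g : seq E -> R) : seq E -> R :=
  iter n path_step g.

(* Expected sum of [f] over the [K] slots that follow a visit to [x]. *)
Fixpoint occupation (K : nat) (f : E -> R) (x : E) : R :=
  if K is K'.+1 then \sum_z p x z * (f z + occupation K' f z) else 0.

Lemma next_law_pmf h : is_pmf (next_law h).
Proof. by case: h => [|x s] //=. Qed.

Lemma next_law_rcons h x : next_law (rcons h x) = p x.
Proof. by case: h => [|y s] //=; rewrite last_rcons. Qed.

Lemma path_ev_le n g g' h :
  (forall s, size s = n -> g (h ++ s) <= g' (h ++ s)) ->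
  path_ev n g h <= path_ev n g' h.
Proof.
elim: n h => [|n IH] h le_g; first by have := le_g [::] erefl; rewrite cats0.
apply: ler_sum => z _; apply: ler_wpM2l; first by case: (next_law_pmf h).
by apply: IH => s sz; rewrite cat_rcons; apply: le_g; rewrite /= sz.
Qed.

Lemma eq_path_ev n g g' h :
  (forall s, size s = n -> g (h ++ s) = g' (h ++ s)) ->
  path_ev n g h = path_ev n g' h.
Proof.
move=> eq_g; apply/eqP; rewrite eq_le.
by apply/andP; split; apply: path_ev_le => s /eq_g ->.
Qed.

Lemma path_ev_lin n a b (g1 g2 : seq E -> R) h :
  path_ev n (fun h => a * g1 h + b * g2 h) h =
  a * path_ev n g1 h + b * path_ev n g2 h.
Proof.
elim: n h => [|n IH] h //=.
rewrite -!/(path_ev _ _) /path_step !mulr_sumr -big_split /=.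
by apply: eq_bigr => z _; rewrite IH; ring.
Qed.

Lemma path_ev_cst n b h : path_ev n (fun=> b) h = b.
Proof.
elim: n h => [|n IH] h //=; rewrite /path_step.
under eq_bigr do rewrite -/(path_ev _ _) IH.
by rewrite -mulr_suml; case: (next_law_pmf h) => _ ->; rewrite mul1r.
Qed.

Lemma path_evD m n g h : path_ev (m + n) g h = path_ev m (path_ev n g) h.
Proof. by rewrite /path_ev iterD. Qed.

(** Markov property: what follows the visit to [x] does not depend on [h]. The [drop] removes [h]
    and the visit itself, so that only the [K] new slots are summed. *)
Lemma path_ev_occupation K (f : E -> R) h x :
  path_ev K (fun h' => \sum_(z <- drop (size h).+1 h') f z) (rcons h x) =
  occupation K f x.
Proof.
elim: K h x => [|K IH] h x.
  by rewrite /= drop_oversize ?size_rcons // big_nil.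
rewrite /path_ev iterS -/(path_ev _ _) /path_step next_law_rcons /=.
apply: eq_bigr => z _; congr (_ * _).
rewrite -(IH (rcons h x) z) size_rcons.
transitivity (path_ev K (fun h' => 1 * f z + 1 *
   (\sum_(z <- drop (size h).+2 h') f z)) (rcons (rcons h x) z)).
  apply: eq_path_ev => s _.
  rewrite !cat_rcons !drop_cat !ltnNge leqnSn (leqW (leqnSn _)) /=.
  by rewrite subSnn -addn2 addKn /= !drop0 big_cons !mul1r.
by rewrite path_ev_lin path_ev_cst !mul1r.
Qed.

Lemma occupation_lin K a b (f g : E -> R) x :
  occupation K (fun z => a * f z + b * g z) x =
  a * occupation K f x + b * occupation K g x.
Proof.
elim: K x => [|K IH] x /=; first by rewrite !mulr0 addr0.
rewrite !mulr_sumr -big_split /=; apply: eq_bigr => z _.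
by rewrite IH; ring.
Qed.

Lemma path_ev_nstep n f x :
  path_ev n (fun h => f (last x h)) [:: x] = \sum_z nstep p n x z * f z.
Proof.
suff H h y : path_ev n (fun h => f (last x h)) (rcons h y) =
    \sum_z nstep p n y z * f z by exact: (H [::]).
elim: n h y => [|n IH] h y.
  rewrite /= last_rcons (bigD1 y) //= eqxx mul1r big1 ?addr0 // => z.
  by rewrite eq_sym => /negPf ->; rewrite mul0r.
rewrite /path_ev iterS -/(path_ev _ _) /path_step next_law_rcons /=.
under eq_bigr do rewrite IH mulr_sumr.
rewrite exchange_big; apply: eq_bigr => z _ /=; rewrite mulr_suml.
by apply: eq_bigr => t _; rewrite mulrA.
Qed.

End PathExpectation.

(** * Threshold decomposition *)

Lemma chan_maxE (N : nat) (S : {set 'I_N}) (x : chan_state N) :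
  chan_max S x = [exists i in S, x i].
Proof.
rewrite /chan_max; case: existsP => [[i /andP[iS xi]]|H] /=.
  apply/eqP; rewrite eqn_leq; apply/andP; split.
    by apply/bigmax_leqP => j _; case: (x j).
  by apply: leq_trans (leq_bigmax_cond (F := fun i => x i : nat) i iS); rewrite xi.
apply/eqP; rewrite -leqn0; apply/bigmax_leqP => i iS.
by case: (boolP (x i)) => // xi; case: H; exists i; rewrite iS.
Qed.

(** For nonnegative weights, the largest weight that a scheduler can collect in a slot; the default
    0 is the value of a slot with no ON channel. *)
Definition best_on (R : realType) (N : nat) (w : 'I_N -> R) (x : chan_state N) : R :=
  \big[Num.max/0]_(i | x i) w i.

(* Splitting off the lowest positive level of [w] leaves a weight vector of
   smaller support. *)
Lemma best_on_peel (R : realType) (N : nat) (w w' : 'I_N -> R) (S : {set 'I_N})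
    (g : R) (x : chan_state N) :
  0 <= g -> (forall i, i \in S -> g <= w i) -> (forall i, i \notin S -> w i = 0) ->
  (forall i, w' i = w i - g * (i \in S)%:R) ->
  best_on w x = best_on w' x + g * (chan_max S x)%:R.
Proof.
move=> g0 gle wS w'E; rewrite chan_maxE.
have w'0 i : 0 <= w' i.
  rewrite w'E; case: (boolP (i \in S)) => iS; last by rewrite wS // mulr0 subr0.
  by rewrite mulr1 subr_ge0 gle.
have bb : 0 <= best_on w x - g * [exists i in S, x i]%:R.
  case: existsP => [[i /andP[iS xi]]|_].
    by rewrite mulr1 subr_ge0 (le_trans (gle _ iS)) //; apply: le_bigmax_cond.
  by rewrite mulr0 subr0; apply: bigmax_ge_id.
have bb' : 0 <= best_on w' x by apply: bigmax_ge_id.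
apply/eqP; rewrite eq_le; apply/andP; split.
  apply: bigmax_le => [|i xi]; first by rewrite addr_ge0 // mulr_ge0 // ler0n.
  have -> : w i = w' i + g * (i \in S)%:R by rewrite w'E; ring.
  apply: lerD; first exact: le_bigmax_cond.
  apply: ler_wpM2l => //; rewrite ler_nat.
  by case: (boolP (i \in S)) => // iS; rewrite lt0b; apply/existsP; exists i; rewrite iS.
rewrite -lerBrDr; apply: bigmax_le => // i xi.
rewrite w'E; case: (boolP (i \in S)) => iS; last by rewrite wS // mulr0 subr0.
rewrite (_ : [exists _ in _, _] = true); last by apply/existsP; exists i; rewrite iS.
by rewrite lerD2r; apply: le_bigmax_cond.
Qed.

(** Induction on the size of the support [S] of [w]: peel off the lowest positive level. [S] is
    proper because [w] vanishes somewhere, so the slack at [S] applies to the peeled layer. [Lam]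
    will be the expected sum over a block. *)
Lemma threshold_domination (R : realType) (N : nat) (mu : 'I_N -> R) (delta : R)
    (Lam : (chan_state N -> R) -> R) :
  Lam (fun=> 0) = 0 ->
  (forall f g a, Lam (fun x => f x + a * g x) = Lam f + a * Lam g) ->
  (forall S : {set 'I_N}, S != finset.set0 -> S \proper [set: 'I_N]%SET ->
     \sum_(i in S) mu i + delta <= Lam (fun x => (chan_max S x)%:R)) ->
  forall w : 'I_N -> R, (forall i, 0 <= w i) -> (exists i, w i = 0) ->
  0 <= delta ->
  forall j, \sum_i w i * mu i + delta * w j <= Lam (best_on w).
Proof.
move=> Lam0 LamD LamS w w0 wz d0.
have [n] := ubnP #|[set i | w i != 0]%SET|.
elim: n w w0 wz => // n IH w w0 wz; rewrite ltnS => szw j.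
set S : {set 'I_N} := [set i | w i != 0]%SET in szw.
have inS i : (i \in S) = (w i != 0) by rewrite inE.
have [S0|] := eqVneq S finset.set0.
  have w00 i : w i = 0.
    by apply/eqP; apply: contraT; rewrite -inS S0 finset.in_set0.
  have -> : best_on w = fun=> 0.
    apply/funext => x; apply/eqP; rewrite eq_le bigmax_ge_id andbT.
    by apply: bigmax_le => // i _; rewrite w00.
  by rewrite Lam0 w00 mulr0 addr0 big1 // => i _; rewrite w00 mul0r.
move=> Sn0; have /set0Pn [i0 i0S] := Sn0.
have Sp : S \proper [set: 'I_N]%SET.
  rewrite properT; apply/negP => /eqP ST.
  by case: wz => i wi0; have := inS i; rewrite ST finset.in_setT wi0 eqxx.
pose k := [arg min_(i < i0 in S) w i]%O.
have [kS kmin] : k \in S /\ forall i, i \in S -> w k <= w i.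
  by rewrite /k; case: arg_minP.
pose w' i := w i - w k * (i \in S)%:R.
have wkn0 : w k != 0 by rewrite -inS.
have w'k : w' k = 0 by rewrite /w' kS mulr1 subrr.
have w'0 i : 0 <= w' i.
  rewrite /w'; case: (boolP (i \in S)) => iS; last by rewrite mulr0 subr0.
  by rewrite mulr1 subr_ge0 kmin.
have wNS i : i \notin S -> w i = 0 by rewrite inS negbK => /eqP.
have -> : best_on w = fun x => best_on w' x + w k * (chan_max S x)%:R.
  by apply/funext => x; apply: best_on_peel.
rewrite LamD.
have lt' : (#|[set i | w' i != 0%R]%SET| < n)%N.
  apply: leq_trans szw; apply: proper_card; apply/properP; split.
    apply/fintype.subsetP => i; rewrite !inE; apply: contra => /eqP wi.
    by rewrite /w' inS wi eqxx mulr0 subr0.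
  by exists k => //; rewrite inE w'k eqxx.
have := IH w' w'0 (ex_intro _ k w'k) lt' j.
have -> : \sum_i w i * mu i = \sum_i w' i * mu i + w k * \sum_(i in S) mu i.
  rewrite mulr_sumr [in X in _ + X]big_mkcond -big_split /=.
  by apply: eq_bigr => i _; rewrite /w'; case: (i \in S); rewrite /=; ring.
(* One peel lowers the weight of [j] by at most [w k], and the slack of this layer is worth exactly
   [delta * w k]. *)
have : w j <= w' j + w k.
  by rewrite /w'; case: (boolP (j \in S)) => jS /=; rewrite ?mulr1 ?subrK // mulr0 subr0 lerDl.
move=> /(ler_wpM2l d0) wj IHj.
have := ler_wpM2l (w0 k) (LamS S Sn0 Sp).
lra.
Qed.

(** * The weighted-deficit policy *)

Section WeightedDeficit.
Set Implicit Arguments.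
Unset Strict Implicit.
Variables (R : realType) (N : nat) (mu c : 'I_N -> R).
Hypothesis c_gt0 : forall i, 0 < c i.

Notation history := (seq (chan_state N * option 'I_N)).

Definition deficit (h : history) (i : 'I_N) : R :=
  (size h)%:R * mu i - (count (fun q => q.2 == Some i) h)%:R.

(** The picked [i0] only certifies that some channel is ON, as [arg max] requires. *)
Definition serve (h : history) (x : chan_state N) : option 'I_N :=
  if [pick i | x i] is Some i0
  then Some [arg max_(i > i0 | x i) (deficit h i / c i)]%O else None.

(** Replaying the policy on a channel sequence makes the deficits functions of the channels alone,
    hence of the trajectory of the chain. *)
Definition serve_history (s : seq (chan_state N)) : history :=
  foldl (fun h x => rcons h (x, serve h x)) [::] s.

Definition path_deficit (s : seq (chan_state N)) : 'I_N -> R :=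
  deficit (serve_history s).

Definition served (s : seq (chan_state N)) (x : chan_state N) (i : 'I_N) : bool :=
  serve (serve_history s) x == Some i.

Definition total_deficit s : R := \sum_i path_deficit s i.

Definition total_weight : R := \sum_i c i.

(* Normalized deviation of the deficits from the ray spanned by [c]. *)
Definition imbalance s i : R :=
  path_deficit s i / c i - total_deficit s / total_weight.

Definition lyapunov s : R := \sum_i c i * imbalance s i ^+ 2.

Lemma serve_history_rcons s x :
  serve_history (rcons s x) = rcons (serve_history s) (x, serve (serve_history s) x).
Proof. by rewrite /serve_history foldl_rcons. Qed.

Lemma path_deficit_rcons s x i :
  path_deficit (rcons s x) i = path_deficit s i + (mu i - (served s x i)%:R).
Proof.
rewrite /path_deficit /deficit serve_history_rcons size_rcons -cats1 count_cat /=.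
by rewrite addn0 -(addn1 (size _)) !natrD; ring.
Qed.

Variant serve_spec (h : history) (x : chan_state N) : option 'I_N -> Prop :=
| ServeSome k of x k & (forall i, x i -> deficit h i / c i <= deficit h k / c k) :
    serve_spec h x (Some k)
| ServeNone of (forall i, ~~ x i) : serve_spec h x None.

Lemma serveP h x : serve_spec h x (serve h x).
Proof.
rewrite /serve; case: pickP => [i0 xi0|x0]; last first.
  by constructor => i; rewrite x0.
by case: arg_maxP => // k xk kmax; constructor.
Qed.

Lemma sum_served s x :
  \sum_i (served s x i)%:R = (chan_max [set: 'I_N]%SET x)%:R :> R.
Proof.
rewrite chan_maxE /served; case: serveP => [k xk _|x0].
  rewrite (bigD1 k) //= eqxx big1 ?addr0 => [|i ik]; last first.
    by rewrite (inj_eq Some_inj) eq_sym (negPf ik).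
  by congr (_%:R); case: existsP => // -[]; exists k; rewrite finset.in_setT.
rewrite big1 // (_ : [exists _ in _, _] = false) //.
by apply/existsP => -[i]; rewrite (negPf (x0 i)) andbF.
Qed.

(** Exactly one client is served whenever some channel is ON, so the total evolves independently of
    the choice made. *)
Lemma total_deficit_rcons s x :
  total_deficit (rcons s x) =
  total_deficit s + (\sum_i mu i - (chan_max [set: 'I_N]%SET x)%:R).
Proof.
rewrite /total_deficit -(sum_served s) -sumrB -big_split /=.
by apply: eq_bigr => i _; rewrite path_deficit_rcons.
Qed.

Hypothesis N_gt0 : (0 < N)%N.

Lemma total_weight_gt0 : 0 < total_weight.
Proof.
rewrite /total_weight (bigD1 (Ordinal N_gt0)) //= ltr_pwDl //.
by apply: sumr_ge0 => i _; apply: ltW.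
Qed.

Lemma sum_imbalance s : \sum_i c i * imbalance s i = 0.
Proof.
under eq_bigr => i _ do rewrite /imbalance mulrBr mulrCA mulfV ?gt_eqF // mulr1.
rewrite sumrB -mulr_suml -/total_weight -/(total_deficit s).
by rewrite mulrC divfK ?subrr // gt_eqF // total_weight_gt0.
Qed.

Lemma imbalance_rcons_bound :
  exists2 L, 0 <= L & forall s x i, `|imbalance (rcons s x) i - imbalance s i| <= L.
Proof.
(* [B] bounds the one-slot change of each deficit and of the total deficit. *)
pose B := 1 + \sum_i `|mu i|.
exists (\sum_i B / c i + B / total_weight).
  have B0 : 0 <= B by rewrite addr_ge0 ?ler01 // sumr_ge0.
  by rewrite addr_ge0 ?sumr_ge0 // => [i _|]; rewrite divr_ge0 // ltW // total_weight_gt0.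
move=> s x i; have cW := total_weight_gt0.
rewrite /imbalance path_deficit_rcons total_deficit_rcons.
rewrite [X in `|X|](_ : _ = (mu i - (served s x i)%:R) / c i -
  (\sum_i mu i - (chan_max [set: 'I_N]%SET x)%:R) / total_weight); last by ring.
have nat01 (b : bool) : `|b%:R : R| <= 1 by case: b; rewrite ?normr1 ?normr0.
apply: le_trans (ler_normB _ _) _; apply: lerD.
  apply: (@le_trans _ _ (B / c i)).
    rewrite normrM (@ger0_norm _ (c i)^-1) ?invr_ge0 ?(ltW (c_gt0 i)) //.
    apply: ler_wpM2r; first by rewrite invr_ge0 ltW.
    apply: le_trans (ler_normB _ _) _; rewrite addrC; apply: lerD => //.
    by rewrite (bigD1 i) //= lerDl sumr_ge0.
  rewrite (bigD1 i) //= lerDl sumr_ge0 // => j _.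
  by rewrite divr_ge0 ?(ltW (c_gt0 _)) // addr_ge0 ?ler01 // sumr_ge0.
rewrite normrM (@ger0_norm _ total_weight^-1) ?invr_ge0 ?(ltW cW) //.
apply: ler_wpM2r; first by rewrite invr_ge0 ltW.
apply: le_trans (ler_normB _ _) _; rewrite addrC; apply: lerD => //.
  by rewrite chan_maxE.
exact: ler_norm_sum.
Qed.

Lemma imbalance_cat_bound L :
  (forall s x i, `|imbalance (rcons s x) i - imbalance s i| <= L) ->
  forall s s' i, `|imbalance (s ++ s') i - imbalance s i| <= L * (size s')%:R.
Proof.
move=> HL s s' i; elim/last_ind: s' => [|s' x IH].
  by rewrite cats0 subrr normr0 mulr0.
rewrite -rcons_cat size_rcons -addn1 natrD mulrDr mulr1.
rewrite [X in `|X|](_ : _ = (imbalance (s ++ s') i - imbalance s i) +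
   (imbalance (rcons (s ++ s') x) i - imbalance (s ++ s') i)); last by ring.
exact: le_trans (ler_normD _ _) (lerD IH (HL _ _ _)).
Qed.

Lemma lyapunov_ge0 s : 0 <= lyapunov s.
Proof. by apply: sumr_ge0 => i _; rewrite mulr_ge0 ?sqr_ge0 // ltW. Qed.

(* The total deficit drops out of the first-order term since
   [\sum_i c i * imbalance s i = 0]. *)
Lemma lyapunovE s s' :
  lyapunov s' = lyapunov s +
    2 * (\sum_i imbalance s i * (path_deficit s' i - path_deficit s i)) +
    \sum_i c i * (imbalance s' i - imbalance s i) ^+ 2.
Proof.
have -> : \sum_i imbalance s i * (path_deficit s' i - path_deficit s i) =
  \sum_i c i * imbalance s i * (imbalance s' i - imbalance s i).
  have /(congr1 (fun z => z * ((total_deficit s' - total_deficit s) / total_weight))) :=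
    sum_imbalance s.
  rewrite mul0r mulr_suml => H; rewrite -[RHS]addr0 -[X in _ = _ + X]H -big_split /=.
  apply: eq_bigr => i _; rewrite /imbalance.
  have := total_weight_gt0; move: (c_gt0 i) => /gt_eqF ci /gt_eqF cW.
  by field; rewrite ci cW.
rewrite mulr_sumr -!big_split /=; apply: eq_bigr => i _; ring.
Qed.

Lemma imbalance_le_serve s x k : serve (serve_history s) x = Some k ->
  x k /\ forall i, x i -> imbalance s i <= imbalance s k.
Proof.
move=> E; move: (serveP (serve_history s) x); rewrite E => H.
inversion H as [k' xk kmax Ek|]; split=> // i xi.
by rewrite /imbalance lerD2r kmax.
Qed.

(* Serving by the current deficits loses at most [2 L K] per slot against
   serving by the imbalances [imbalance s] frozen at the start of a block. *)
Lemma block_gain L K b s s' :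
  0 <= L ->
  (forall s x i, `|imbalance (rcons s x) i - imbalance s i| <= L) ->
  (forall i, b <= imbalance s i) -> (size s' <= K)%N ->
  \sum_i imbalance s i * (path_deficit (s ++ s') i - path_deficit s i) <=
  \sum_(x <- s') (\sum_i imbalance s i * mu i -
     (b * (chan_max [set: 'I_N]%SET x)%:R + best_on (fun i => imbalance s i - b) x)
     + 2 * L * K%:R).
Proof.
move=> L0 HL bmin; elim/last_ind: s' => [|s' x IH] szs.
  by rewrite cats0 big_nil big1 // => i _; rewrite subrr mulr0.
rewrite size_rcons in szs.
rewrite big_rcons /= -rcons_cat.
under eq_bigr => i _ do rewrite path_deficit_rcons addrAC mulrDr.
rewrite big_split /=; apply: lerD; first exact: IH (ltnW szs).
have LK : L * (size s')%:R <= L * K%:R by rewrite ler_wpM2l // ler_nat ltnW.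
have LK0 : 0 <= L * K%:R by rewrite mulr_ge0 // ler0n.
under eq_bigr => i _ do rewrite mulrBr.
rewrite sumrB -addrA lerD2l.
suff : b * (chan_max [set: 'I_N]%SET x)%:R +
    best_on (fun i => imbalance s i - b) x <=
    \sum_i imbalance s i * (served (s ++ s') x i)%:R + 2 * L * K%:R by lra.
have := @imbalance_le_serve (s ++ s') x; rewrite chan_maxE /served.
case: serveP => [k xk _|x0].
  move=> /(_ k erefl) [_ kmax].
  rewrite (bigD1 k) //= eqxx mulr1 big1 ?addr0; last first.
    by move=> i ik; rewrite (inj_eq Some_inj) eq_sym (negPf ik) mulr0.
  rewrite (_ : [exists _ in _, _] = true) /= ?mulr1; last first.
    by apply/existsP; exists k; rewrite finset.in_setT.
  rewrite -lerBrDl; apply: bigmax_le => [|i xi].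
    have := bmin k; lra.
  have := kmax i xi; have := imbalance_cat_bound HL s s' i.
  have := imbalance_cat_bound HL s s' k.
  rewrite !ler_norml => /andP[? ?] /andP[? ?]; lra.
move=> _; rewrite (_ : [exists _ in _, _] = false) /=; last first.
  by apply/existsP => -[i]; rewrite (negPf (x0 i)) andbF.
have -> : best_on (fun i => imbalance s i - b) x = 0.
  by rewrite /best_on big_pred0 // => i; apply/negbTE.
by rewrite mulr0 addr0 big1 ?add0r; [lra | move=> i _; rewrite mulr0].
Qed.

End WeightedDeficit.

(** * Drift of the squared Lyapunov function *)

Section Drift.
Set Implicit Arguments.
Unset Strict Implicit.
Variables (R : realType) (N : nat) (mu c : 'I_N -> R).
Hypothesis c_gt0 : forall i, 0 < c i.
Hypothesis N_gt0 : (0 < N)%N.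

Let W := total_weight c.
Let W_gt0 : 0 < W := total_weight_gt0 c_gt0 N_gt0.

(** The imbalances have zero sum against the positive weights [c], so their extremes lie on either
    side of 0. *)
Lemma imbalance_spread s :
  exists j k, let u := imbalance mu c s in
    [/\ forall i, u k <= u i, forall i, u i <= u j, u k <= 0 & 0 <= u j].
Proof.
pose u := imbalance mu c s; pose i0 := Ordinal N_gt0.
pose j := [arg max_(i > i0) u i]%O; pose k := [arg min_(i < i0) u i]%O.
have umax i : u i <= u j by rewrite /j; case: arg_maxP => // j' _; apply.
have umin i : u k <= u i by rewrite /k; case: arg_minP => // k' _; apply.
have S0 : \sum_i c i * u i = 0 by apply: sum_imbalance.
exists j, k; split => //.
  rewrite leNgt; apply/negP => uk; suff : 0 < \sum_i c i * u i by rewrite S0 ltxx.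
  rewrite (bigD1 k) //= ltr_pwDl ?mulr_gt0 //.
  by apply: sumr_ge0 => i _; rewrite mulr_ge0 ?(ltW (c_gt0 i)) // (le_trans (ltW uk)).
rewrite leNgt; apply/negP => uj; suff : 0 < \sum_i c i * (- u i).
  by under eq_bigr do rewrite mulrN; rewrite sumrN S0 oppr0 ltxx.
rewrite (bigD1 j) //= ltr_pwDl ?mulr_gt0 ?oppr_gt0 //.
by apply: sumr_ge0 => i _; rewrite mulr_ge0 ?(ltW (c_gt0 i)) // oppr_ge0 (le_trans (umax i)) // ltW.
Qed.

(** The 4 comes from bounding a squared difference by twice the sum of the two squares; the 1 makes
    [a] visibly positive. *)
Let a : R := 1 + 4 * \sum_i (c i)^-1.

Let a_gt0 : 0 < a.
Proof.
by rewrite ltr_pwDl // mulr_ge0 // sumr_ge0 // => i _; rewrite invr_ge0 ltW.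
Qed.

Lemma sqr_imbalance_le s i :
  imbalance mu c s i ^+ 2 <= (\sum_i (c i)^-1) * lyapunov mu c s.
Proof.
have V0 := lyapunov_ge0 mu c_gt0 s.
apply: (@le_trans _ _ ((c i)^-1 * lyapunov mu c s)).
  rewrite ler_pdivlMl // /lyapunov (bigD1 i) //= lerDl.
  by apply: sumr_ge0 => k _; rewrite mulr_ge0 ?sqr_ge0 // ltW.
apply: ler_wpM2r => //; rewrite (bigD1 i) //= lerDl.
by apply: sumr_ge0 => k _; rewrite invr_ge0 ltW.
Qed.

Lemma sqr_spread_le s j k :
  (imbalance mu c s j - imbalance mu c s k) ^+ 2 <= a * lyapunov mu c s.
Proof.
have V0 := lyapunov_ge0 mu c_gt0 s.
have := sqr_imbalance_le s j; have := sqr_imbalance_le s k.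
rewrite /a; set X := imbalance _ _ _ j; set Y := imbalance _ _ _ k.
set q := \sum_i _; set V := lyapunov _ _ _ in V0 * => HY HX.
have := sqr_ge0 (X + Y); nra.
Qed.

Lemma lyapunov_le s r :
  (forall i, `|imbalance mu c s i| <= r) -> lyapunov mu c s <= W * r ^+ 2.
Proof.
move=> ur; rewrite /lyapunov /W /total_weight mulr_suml; apply: ler_sum => i _.
apply: ler_wpM2l; first exact: ltW.
rewrite -real_normK ?num_real //.
by rewrite lerXn2r ?nnegrE //; apply: le_trans (ur i).
Qed.

Lemma lyapunov_increment s s' r L :
  (forall i, `|imbalance mu c s i| <= r) ->
  (forall i, `|imbalance mu c s' i - imbalance mu c s i| <= L) ->
  `|lyapunov mu c s' - lyapunov mu c s| <= W * (L * (2 * r + L)).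
Proof.
move=> ur uL; rewrite /lyapunov -sumrB /W /total_weight mulr_suml.
apply: le_trans (ler_norm_sum _ _ _) _; apply: ler_sum => i _.
rewrite -mulrBr normrM (gtr0_norm (c_gt0 i)); apply: ler_wpM2l; first exact: ltW.
rewrite subr_sqr normrM; apply: ler_pM => //.
rewrite [X in `|X|](_ : _ = 2 * imbalance mu c s i +
  (imbalance mu c s' i - imbalance mu c s i)); last by ring.
apply: le_trans (ler_normD _ _) _; apply: lerD => //.
by rewrite normrM ger0_norm // ler_wpM2l.
Qed.

(** Below [beta / alpha] the cubic term is dropped; above it the left side is nonpositive. This lets
    the cubic drift absorb the quadratic errors. *)
Lemma cubic_bound (alpha beta r : R) : 0 < alpha -> 0 <= beta -> 0 <= r ->
  beta * r ^+ 2 - alpha * r ^+ 3 <= beta * (beta / alpha) ^+ 2.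
Proof.
move=> al be r0; have q0 : 0 <= beta / alpha by rewrite divr_ge0 // ltW.
have eb : beta = alpha * (beta / alpha) by rewrite mulrC divfK // gt_eqF.
have [rq|rq] := leP r (beta / alpha).
  apply: (@le_trans _ _ (beta * r ^+ 2)).
    by rewrite gerBl mulr_ge0 ?exprn_ge0 // ltW.
  by rewrite ler_wpM2l // lerXn2r.
apply: (@le_trans _ _ 0); last by rewrite mulr_ge0 ?sqr_ge0.
rewrite subr_le0 (exprS r 2) mulrA ler_wpM2r ?sqr_ge0 // {1}eb ler_wpM2l // ltW //.
Qed.

Variables (E : finType) (init : E -> R) (p : E -> E -> R) (chan : E -> chan_state N).
Hypothesis init_pmf : is_pmf init.
Hypothesis p_pmf : forall x, is_pmf (p x).
Variables (K : nat) (delta : R).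
Hypothesis delta_gt0 : 0 < delta.
Hypothesis K_gt0 : (0 < K)%N.

Let X (S : {set 'I_N}) (z : E) : R := (chan_max S (chan z))%:R.

Hypothesis occ_proper : forall x (S : {set 'I_N}),
  S != finset.set0 -> S \proper [set: 'I_N]%SET ->
  K%:R * (\sum_(i in S) mu i + delta) <= occupation p K (X S) x.
Hypothesis occ_total : forall x,
  `|occupation p K (X [set: 'I_N]%SET) x - K%:R * \sum_i mu i| <= K%:R * (delta / 2).

(** Write [u] as its minimum [u k] plus a nonnegative weight that vanishes at [k]. Threshold
    domination gives the second part a gain [K * delta * (u j - u k)]. The constant part errs by at
    most [- u k * K * delta / 2], which is at most half of that gain because [0 <= u j]. *)
Lemma frozen_gain x (u : 'I_N -> R) j k :
  (forall i, u k <= u i) -> (forall i, u i <= u j) -> u k <= 0 -> 0 <= u j ->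
  K%:R * (\sum_i u i * mu i + delta / 2 * (u j - u k)) <=
  occupation p K (fun z => u k * X [set: 'I_N]%SET z +
                       best_on (fun i => u i - u k) (chan z)) x.
Proof.
move=> umin umax uk uj.
have -> : (fun z => u k * X [set: 'I_N]%SET z + best_on (fun i => u i - u k) (chan z)) =
          (fun z => u k * X [set: 'I_N]%SET z + 1 * best_on (fun i => u i - u k) (chan z)).
  by apply/funext => z; rewrite mul1r.
rewrite occupation_lin mul1r.
have := @threshold_domination R N (fun i => K%:R * mu i) (K%:R * delta)
  (fun f => occupation p K (f \o chan) x).
have -> : occupation p K ((fun=> 0) \o chan) x = 0.
  transitivity (occupation p K (fun=> 0 * 0 + 0 * 0) x).
    by congr (occupation p K _ x); apply/funext => z /=; rewrite mul0r addr0.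
  by rewrite (@occupation_lin _ _ p K 0 0 (fun=> 0) (fun=> 0)) !mul0r addr0.
move=> /(_ erefl) H.
have {}H := H _ _ (fun i => u i - u k) _ _ _ j.
have {}H : \sum_i (u i - u k) * (K%:R * mu i) + K%:R * delta * (u j - u k) <=
    occupation p K (best_on (fun i => u i - u k) \o chan) x.
  apply: H => [f g b|S S0 Sp|i||].
  - rewrite -[occupation p K (f \o chan) x]mul1r -occupation_lin.
    by congr (occupation p K _ x); apply/funext => z /=; rewrite mul1r.
  - by rewrite -mulr_sumr -mulrDr; apply: occ_proper.
  - by rewrite subr_ge0.
  - by exists k; rewrite subrr.
  - by rewrite mulr_ge0 // ltW.
have E1 : \sum_i (u i - u k) * (K%:R * mu i) =
    K%:R * \sum_i u i * mu i - u k * (K%:R * \sum_i mu i).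
  rewrite !mulr_sumr -sumrB; apply: eq_bigr => i _; ring.
move: H; rewrite E1 /comp.
have := occ_total x; rewrite ler_norml => /andP[_].
set O := occupation p K (X _) x; set B := occupation _ _ _ _.
set Sm := \sum_i mu i; set Su := \sum_i u i * mu i; move=> HO HB.
have K0 : 0 <= K%:R :> R by [].
have D0 : 0 <= K%:R * delta by rewrite mulr_ge0 // ltW.
have : - u k * (O - K%:R * Sm) <= - u k * (K%:R * (delta / 2)).
  by rewrite ler_wpM2l // oppr_ge0.
have : 0 <= K%:R * delta * u j by rewrite mulr_ge0.
nra.
Qed.

Let V h : R := lyapunov mu c (map chan h).

(** Expand [V' ^+ 2 = V ^+ 2 + 2 * V * (V' - V) + (V' - V) ^+ 2] over a block. [V] is comparable to
    the squared spread [r ^+ 2], so the gain is of order [r ^+ 3] and every error is of order at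
    most [r ^+ 2]. *)
Lemma sqr_lyapunov_drift :
  exists2 C, 0 <= C & forall h x,
    path_ev init p K (fun h => V h ^+ 2) (rcons h x) <= V (rcons h x) ^+ 2 + C.
Proof.
have [L L0 HL] := imbalance_rcons_bound mu c_gt0 N_gt0.
(* [B] bounds the change of an imbalance over a block. In [C1] below, [4 * (B * K)] is twice the
   freezing loss [2 * L * K] summed over [K] slots, and [W * B ^+ 2] bounds the second-order term of
   [lyapunovE]. *)
pose B := L * K%:R; have B0 : 0 <= B by rewrite mulr_ge0.
pose C1 := 4 * (B * K%:R) + W * B ^+ 2.
have C10 : 0 <= C1 by rewrite addr_ge0 // !mulr_ge0 // ?sqr_ge0 // ltW.
pose A := (W * B) ^+ 2.
(* [beta] collects the errors through [V <= W * r ^+ 2], and [alpha] the gain through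
   [r ^+ 2 / a <= V]. *)
pose beta := 2 * C1 * W + 8 * A; pose alpha := 2 * (K%:R * delta) / a.
have A0 : 0 <= A by rewrite sqr_ge0.
have beta0 : 0 <= beta by rewrite addr_ge0 ?mulr_ge0 // ltW.
have alpha0 : 0 < alpha by rewrite divr_gt0 // !mulr_gt0 // ltr0n.
pose C := beta * (beta / alpha) ^+ 2 + 2 * A * B ^+ 2.
exists C; first by rewrite addr_ge0 // mulr_ge0 ?sqr_ge0 // mulr_ge0.
move=> h0 x; set h := rcons h0 x; set s := map chan h.
have [j [k /= []]] := imbalance_spread s.
set u := imbalance mu c s => umin umax uk uj.
pose r := u j - u k; have r0 : 0 <= r by rewrite subr_ge0.
have ur i : `|u i| <= r.
  by rewrite ler_norml; apply/andP; split; have := umin i; have := umax i; rewrite /r; lra.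
pose phi z := u k * X [set: 'I_N]%SET z + best_on (fun i => u i - u k) (chan z).
pose Su := \sum_i u i * mu i.
have V0 : 0 <= V h by exact: lyapunov_ge0.
(* [F] dominates [V ^+ 2] at the end of the block and is affine in the block sum of [phi], so its
   expectation reduces to an [occupation]. *)
pose F h' := - (4 * V h) * (\sum_(z <- drop (size h0).+1 h') phi z) +
  1 * (V h ^+ 2 + 2 * V h * (2 * K%:R * Su + C1) + A * (8 * r ^+ 2 + 2 * B ^+ 2)).
apply: (@le_trans _ _ (path_ev init p K F h)).
  apply: path_ev_le => // s' ss'.
  have uB i : `|imbalance mu c (s ++ map chan s') i - u i| <= B.
    by rewrite /B -ss' -(size_map chan); apply: imbalance_cat_bound.
  have I1 : V (h ++ s') - V h <= 2 * K%:R * Su - 2 * (\sum_(z <- s') phi z) + C1.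
    have HQ : \sum_i c i * (imbalance mu c (s ++ map chan s') i - u i) ^+ 2 <= W * B ^+ 2.
      rewrite /W /total_weight mulr_suml; apply: ler_sum => i _.
      apply: ler_wpM2l; first exact: ltW.
      by rewrite -real_normK ?num_real // lerXn2r ?nnegrE.
    have := @block_gain R N mu c L K (u k) s (map chan s') L0 HL umin.
    rewrite size_map ss' leqnn => /(_ erefl).
    rewrite big_map big_split sumrB !big_const_seq !count_predT ss' !iter_addr !addr0 /=.
    rewrite -[(\sum_i _) *+ K]mulr_natr -[(2 * L * _) *+ K]mulr_natr -/u -/Su.
    rewrite -/(phi _) => HG.
    have := lyapunovE mu c_gt0 N_gt0 s (s ++ map chan s').
    rewrite {1}/V map_cat -/u => ->; rewrite -/s -/(V h) /C1 /B in HQ *.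
    move: HG HQ; set G := \sum_i _; set P := \sum_(i <- s') _.
    by set Q := \sum_i c i * _; lra.
  have I2 : (V (h ++ s') - V h) ^+ 2 <= A * (8 * r ^+ 2 + 2 * B ^+ 2).
    have := lyapunov_increment ur uB; rewrite -map_cat -/(V _) -/(V h) => I.
    rewrite -real_normK ?num_real //.
    apply: (@le_trans _ _ ((W * (B * (2 * r + B))) ^+ 2)).
      by rewrite lerXn2r ?nnegrE // mulr_ge0 ?(ltW W_gt0) // mulr_ge0 // addr_ge0 // mulr_ge0.
    rewrite mulrA exprMn -/A ler_wpM2l //; have := sqr_ge0 (2 * r - B); nra.
  rewrite /F drop_size_cat ?size_rcons //.
  rewrite mul1r; move: I1 I2; set V' := V (h ++ s'); set P := \sum_(z <- s') _.
  move=> /(ler_wpM2l V0); nra.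
rewrite /F path_ev_lin // path_ev_cst // mul1r path_ev_occupation //.
have /(ler_wpM2l V0) Hphi := frozen_gain x umin umax uk uj.
rewrite -/Su -/phi -/r in Hphi; rewrite -/phi; set O := occupation _ _ _ _ in Hphi *.
have V1 : V h <= W * r ^+ 2 by apply: lyapunov_le.
have V2 : r ^+ 2 / a <= V h by rewrite ler_pdivrMr // mulrC sqr_spread_le.
have := cubic_bound alpha0 beta0 r0; rewrite /C.
have : r * (K%:R * delta) * (r ^+ 2 / a) <= r * (K%:R * delta) * V h.
  by rewrite ler_wpM2l // mulr_ge0 // mulr_ge0 // ltW.
have := ler_wpM2l C10 V1.
have -> : alpha * r ^+ 3 = 2 * (r * (K%:R * delta) * (r ^+ 2 / a)) by rewrite /alpha; ring.
set Y := r * _ * (_ / a); set Z := beta * (beta / _) ^+ 2.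
have -> : beta * r ^+ 2 = 2 * (C1 * (W * r ^+ 2)) + 8 * A * r ^+ 2 by rewrite /beta; ring.
move=> H1 H2 H3; nra.
Qed.

(** Strong induction removing the last [K] slots at the price of one drift constant. For [n <= K]
    the imbalances, which start at 0, are at most [L * K], whence the constant [D]. *)
Lemma path_ev_sqr_lyapunov_linear :
  exists C, forall n, path_ev init p n (fun h => V h ^+ 2) [::] <= C * n.+1%:R.
Proof.
have [C C0 HC] := sqr_lyapunov_drift.
have [L L0 HL] := imbalance_rcons_bound mu c_gt0 N_gt0.
have imb0 i : imbalance mu c [::] i = 0.
  rewrite /imbalance /total_deficit /path_deficit /deficit /= big1; last first.
    by move=> ? _; rewrite mul0r subrr.
  by rewrite mul0r subrr !mul0r subrr.
pose D := (W * (L * K%:R) ^+ 2) ^+ 2.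
have D0 : 0 <= D by rewrite sqr_ge0.
exists (D + C) => n; elim/ltn_ind: n => n IH.
have [nK|Kn] := leqP n K.
  apply: (@le_trans _ _ D); last first.
    by rewrite -[X in X <= _]mulr1 ler_pM // ?lerDl // ler1n.
  rewrite -(path_ev_cst init_pmf p_pmf n D [::]); apply: path_ev_le => // s sn.
  rewrite lerXn2r ?nnegrE ?lyapunov_ge0 ?mulr_ge0 ?(ltW W_gt0) //.
  apply: lyapunov_le => i.
  have := imbalance_cat_bound HL [::] (map chan s) i.
  rewrite imb0 subr0 /= size_map sn => /le_trans; apply.
  by rewrite ler_wpM2l // ler_nat.
(* The drift bound is stated for nonempty histories, so at least one slot must precede the removed
   block. *)
have [m Em] : exists m, n = (m.+1 + K)%N by exists (n - K).-1; lia.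
have mn : (m.+1 < n)%N by rewrite Em -[X in (X < _)%N]addn0 ltn_add2l.
rewrite Em path_evD.
apply: (@le_trans _ _ (path_ev init p m.+1 (fun h => 1 * V h ^+ 2 + 1 * C) [::])).
  apply: path_ev_le => // s; case/lastP: s => // s x _; rewrite !mul1r; exact: HC.
rewrite path_ev_lin // path_ev_cst // !mul1r.
apply: le_trans (lerD (IH _ mn) (lexx C)) _.
have K1 : 1 <= K%:R :> R by rewrite ler1n.
rewrite (_ : (m.+1 + K).+1%:R = m.+2%:R + K%:R); last by rewrite -addSn natrD.
rewrite [in X in _ <= X]mulrDr lerD2l.
by rewrite -[X in X <= _]mulr1 ler_pM // lerDr.
Qed.

End Drift.

(** * Laws of trajectories *)

Section Trajectory.
Set Implicit Arguments.
Unset Strict Implicit.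
Local Open Scope classical_set_scope.
Variables (R : realType) (E : finType) (init : E -> R) (p : E -> E -> R).
Variables (d : measure_display) (T : measurableType d) (P : probability T R).
Variable Y : nat -> T -> E.
Hypothesis init_pmf : is_pmf init.
Hypothesis p_pmf : forall x, is_pmf (p x).
Hypothesis Y_chain : markov_chain init p P Y.

Definition traj (n : nat) (w : T) : seq E := mkseq (fun t => Y t w) n.

Lemma size_traj n w : size (traj n w) = n.
Proof. by rewrite size_mkseq. Qed.

Lemma trajS n w : traj n.+1 w = rcons (traj n w) (Y n w).
Proof. exact: mkseqS. Qed.

(** There are finitely many trajectories of length [n], so [A] may be arbitrary; the induction
    splits on the last state. *)
Lemma measurable_traj n (A : set (seq E)) : measurable [set w | A (traj n w)].
Proof.
elim: n A => [|n IH] A.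
  have [A0|A0] := pselect (A [::]).
    by rewrite (_ : [set _ | _] = setT) //; apply/seteqP; split=> w.
  by rewrite (_ : [set _ | _] = set0) //; apply/seteqP; split=> w.
rewrite (_ : [set _ | _] = \bigcup_(z in [set: E])
    ((Y n @^-1` [set z]) `&` [set w | A (rcons (traj n w) z)])).
  apply: fin_bigcup_measurable => // z _; apply: measurableI; first exact: Y_chain.1.
  exact: IH (fun h => A (rcons h z)).
apply/seteqP; split=> w /=.
  by rewrite trajS => Aw; exists (Y n w).
by move=> [z _ [<-]]; rewrite trajS.
Qed.

Lemma measurable_fun_traj d' (T' : measurableType d') n (g : seq E -> T') :
  measurable_fun setT (fun w => g (traj n w)).
Proof. by move=> _ B _; rewrite setTI; apply: measurable_traj (fun h => B (g h)). Qed.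

Let path_ev_eq_rcons n h z :
  path_ev init p n.+1 (fun h' => (h' == rcons h z)%:R) [::] =
  next_law init p h z * path_ev init p n (fun h' => (h' == h)%:R) [::].
Proof.
rewrite /path_ev iterSr -!/(path_ev _ _ _ _).
transitivity (path_ev init p n (fun h' => next_law init p h z * (h' == h)%:R + 0 * 0) [::]);
  last by rewrite path_ev_lin // mul0r addr0.
apply: eq_path_ev => // s _; rewrite /path_step.
rewrite (bigD1 z) //= eqseq_rcons eqxx andbT big1 ?addr0 => [|y yz].
  by rewrite mul0r addr0; case: eqP => [->|]; rewrite ?mulr0.
by rewrite eqseq_rcons (negPf yz) andbF mulr0.
Qed.

Lemma traj_law n h : size h = n ->
  P [set w | traj n w = h] = (path_ev init p n (fun h' => (h' == h)%:R) [::])%:E.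
Proof.
case: n => [|n] szh.
  move/size0nil: szh => -> /=.
  by rewrite (_ : [set _ | _] = setT) ?probability_setT //; apply/seteqP; split.
have [x0 _] : exists x0 : E, True by case: h szh => [//|x ? _]; exists x.
rewrite (_ : [set _ | _] = [set w | forall t, (t <= n)%N -> Y t w = nth x0 h t]).
  rewrite Y_chain.2; congr (_%:E).
  elim: n h szh => [|n IH] h; case/lastP: h => // h z; rewrite size_rcons => -[szh].
    rewrite path_ev_eq_rcons; move/size0nil: szh => -> /=.
    by rewrite big_ord0 !mulr1.
  rewrite path_ev_eq_rcons -IH // big_ord_recr /= mulrA [RHS]mulrC.
  congr (_ * _ * _); first by rewrite nth_rcons szh.
    by apply: eq_bigr => i _; rewrite !nth_rcons szh !ltnS ltn_ord (ltnW (ltn_ord i)).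
  rewrite !nth_rcons szh ltnn eqxx ltnSn.
  case: h szh => // x h [szh]; rewrite /next_law /=.
  by rewrite (last_nth x0) /= -szh; congr (p _ _).
apply/seteqP; split=> w /=.
  by move=> <- t tn; rewrite nth_mkseq.
move=> H; apply: (@eq_from_nth _ x0); first by rewrite size_traj.
by move=> i; rewrite size_traj => lin; rewrite nth_mkseq // H.
Qed.

(** The bridge from the combinatorial expectations to the probability space: a function of the
    trajectory is a finite combination of indicators of single trajectories, whose probabilities are
    given by [traj_law]. *)
Lemma integral_traj n (g : seq E -> R) : (forall h, 0 <= g h) ->
  (\int[P]_w (g (traj n w))%:E = (path_ev init p n g [::])%:E)%E.
Proof.
move=> g0.
have -> : (fun w => (g (traj n w))%:E) =
    (fun w => \sum_(h : n.-tuple E) ((g h)%:E * (\1_[set w | traj n w = h] w)%:E))%E.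
  apply/funext => w; rewrite sumEFin; congr (_%:E).
  pose h0 : n.-tuple E := Tuple (introT eqP (size_traj n w)).
  rewrite (bigD1 h0) //= indicE mem_set // mulr1 big1 ?addr0 // => h hh0.
  rewrite indicE memNset ?mulr0 //= => Eh; case/eqP: hh0.
  by apply: val_inj; rewrite /= Eh.
have mI (h : n.-tuple E) : measurable_fun [set: T] (fun w => (\1_[set w | traj n w = h] w)%:E : \bar R).
  exact/measurable_EFinP/measurable_indic/(measurable_traj n (fun s => s = h)).
rewrite ge0_integral_sum //; last 2 first.
- by move=> h; apply: measurable_funeM.
- by move=> h w _; rewrite mule_ge0 // lee_fin.
rewrite (_ : path_ev init p n g [::] = \sum_(h : n.-tuple E)
    g h * path_ev init p n (fun h' => (h' == h :> seq E)%:R) [::]).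
  rewrite -sumEFin; apply: eq_bigr => h _.
  rewrite ge0_integralZl_EFin //.
  rewrite integral_indic // ?setIT; last exact: measurable_traj (fun s => s = h).
  by rewrite EFinM; congr (_ * _)%E; have <- := traj_law (size_tuple h).
transitivity (path_ev init p n (fun s => \sum_(h : n.-tuple E) g h * (s == h)%:R) [::]).
  apply: eq_path_ev => // s szs /=; pose h0 : n.-tuple E := Tuple (introT eqP szs).
  rewrite (bigD1 h0) //= eqxx mulr1 big1 ?addr0 // => h hh0.
  by case: eqP => [Es|]; rewrite ?mulr0 //; case/eqP: hh0; apply: val_inj.
elim: (index_enum _) => [|h r IH].
  rewrite big_nil -[RHS](path_ev_cst init_pmf p_pmf n 0 [::]).
  by apply: eq_path_ev => // s _; rewrite big_nil.
rewrite big_cons -IH -[X in _ = _ + X]mul1r -path_ev_lin.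
by apply: eq_path_ev => // s _; rewrite big_cons mul1r.
Qed.

Lemma prob_traj n (A : pred (seq E)) :
  P [set w | A (traj n w)] = (path_ev init p n (fun h => (A h)%:R) [::])%:E.
Proof.
rewrite -integral_traj; last by move=> h.
have <- : (\int[P]_w (\1_[set w | A (traj n w)] w)%:E = P [set w | A (traj n w)])%E.
  by rewrite integral_indic ?setIT //; apply: measurable_traj (fun h => A h).
apply: eq_integral => w _; rewrite indicE; congr ((nat_of_bool _)%:R%:E).
by apply/idP/idP; rewrite ?inE.
Qed.

End Trajectory.

(** * Ergodic averages from every starting state *)

Section Ergodic.
Set Implicit Arguments.
Unset Strict Implicit.
Local Open Scope classical_set_scope.
Variables (R : realType) (E : finType) (init : E -> R) (p : E -> E -> R).
Variables (d : measure_display) (T : measurableType d) (P : probability T R).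
Variable Y : nat -> T -> E.
Hypothesis init_pmf : is_pmf init.
Hypothesis p_pmf : forall x, is_pmf (p x).
Hypothesis p_irreducible : irreducible_chain p.
Hypothesis Y_chain : markov_chain init p P Y.

(** Some state has positive initial mass, and irreducibility leads from it to [x]. The length is
    [n.+1] because slot 0 is listed: the state read is that of slot [n]. *)
Lemma visit_probability_gt0 x :
  exists n, 0 < path_ev init p n.+1 (fun h => (last x h == x)%:R) [::].
Proof.
have [x0 ix0] : exists x0, 0 < init x0.
  apply: contrapT => H; have [i0 is1] := init_pmf.
  suff : \sum_x init x = 0 by rewrite is1 => /eqP; rewrite oner_eq0.
  apply: big1 => y _; apply/eqP; rewrite eq_le i0 andbT leNgt; apply/negP => iy.
  by apply: H; exists y.
have [n nx] := p_irreducible x0 x; exists n.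
have nstep_ge0 k y z : 0 <= nstep p k y z.
  elim: k y => [|k IH] y /=; first by rewrite ler0n.
  by apply: sumr_ge0 => t _; rewrite mulr_ge0 // (p_pmf y).1.
have -> : path_ev init p n.+1 (fun h => (last x h == x)%:R) [::] =
    \sum_y init y * nstep p n y x.
  rewrite /path_ev iterS -/(path_ev _ _ _ _) /path_step /=.
  apply: eq_bigr => y _; congr (_ * _).
  transitivity (path_ev init p n (fun h => (last y h == x)%:R) [:: y]).
    by apply: eq_path_ev => // s _ /=.
  rewrite (path_ev_nstep init p n (fun z => (z == x)%:R)).
  rewrite (bigD1 x) //= eqxx mulr1 big1 ?addr0 // => z /negPf ->.
  by rewrite mulr0.
rewrite (bigD1 x0) //= ltr_pwDl ?mulr_gt0 //.
by apply: sumr_ge0 => y _; rewrite mulr_ge0 // init_pmf.1.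
Qed.

(** Condition on the first [n.+1] slots: given a visit to [x] at their end, the later slots
    contribute [occupation p k f x] and the earlier ones between 0 and [n.+1]. *)
Lemma occupation_visit (f : E -> R) n k x q I :
  (forall z, 0 <= f z <= 1) ->
  q = path_ev init p n.+1 (fun h => (last x h == x)%:R) [::] ->
  I = path_ev init p (n.+1 + k)
    (fun h => (last x (take n.+1 h) == x)%:R * \sum_(z <- h) f z) [::] ->
  q * occupation p k f x <= I <= q * occupation p k f x + n.+1%:R.
Proof.
move=> f01 qE ->; rewrite path_evD.
have step h : size h = n.+1 ->
    path_ev init p k (fun h => (last x (take n.+1 h) == x)%:R * \sum_(z <- h) f z) h =
    (last x h == x)%:R * (\sum_(z <- h) f z + occupation p k f x).
  case/lastP: h => // h y; rewrite size_rcons => -[szh].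
  transitivity (path_ev init p k (fun h' => ((y == x)%:R * \sum_(z <- rcons h y) f z) * 1 +
     (y == x)%:R * \sum_(z <- drop (size h).+1 h') f z) (rcons h y)).
    apply: eq_path_ev => // s _.
    rewrite take_size_cat ?size_rcons ?szh // last_rcons big_cat /=.
    by rewrite drop_size_cat ?size_rcons ?szh // mulrDr mulr1.
  rewrite path_ev_lin path_ev_cst // path_ev_occupation // last_rcons.
  by case: eqP => [->|_]; rewrite ?mul0r ?addr0 ?mul1r ?mulr1.
have sum01 h : size h = n.+1 -> 0 <= \sum_(z <- h) f z <= n.+1%:R.
  move=> <-; apply/andP; split; first by apply: sumr_ge0 => z _; case/andP: (f01 z).
  rewrite -sum1_size natr_sum; apply: ler_sum => z _; by case/andP: (f01 z).
have -> : q * occupation p k f x = path_ev init p n.+1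
    (fun h => occupation p k f x * (last x h == x)%:R + 0 * 0) [::].
  by rewrite path_ev_lin mul0r addr0 mulrC qE.
have -> : path_ev init p n.+1
    (fun h => occupation p k f x * (last x h == x)%:R + 0 * 0) [::] + n.+1%:R =
    path_ev init p n.+1
    (fun h => 1 * (occupation p k f x * (last x h == x)%:R + 0 * 0) + 1 * n.+1%:R) [::].
  by rewrite [RHS]path_ev_lin path_ev_cst // !mul1r.
apply/andP; split; apply: path_ev_le => // h szh; rewrite step //=;
  have /andP[s0 s1] := sum01 h szh; rewrite mul0r addr0.
  by rewrite mulrC ler_wpM2l // lerDr.
rewrite !mul1r mulrDr addrC [X in X + _ <= _]mulrC lerD2l.
by apply: le_trans s1; case: (_ == _); rewrite ?mul1r ?mul0r.
Qed.

(** Transfers the almost sure limit under [init] to a start at [x]: dominated convergence on the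
    event [D] of being at [x] in slot [n] gives the limit [m * q], and by [occupation_visit] the
    integral is [q] times the average from [x] up to a bounded boundary term. *)
Lemma occupation_average (f : E -> R) (m : R) x :
  (forall z, 0 <= f z <= 1) ->
  {ae P, forall w, (\sum_(t < n) f (Y t w)) / n%:R @[n --> \oo] --> m} ->
  forall e : R, 0 < e -> \forall k \near \oo,
    `|occupation p k f x - k%:R * m| <= k%:R * e.
Proof.
move=> f01 Hm e e0.
have [n] := visit_probability_gt0 x.
set q := path_ev _ _ _ _ _ => q0.
pose D := [set w | Y n w = x].
have mD : measurable D by exact: Y_chain.1.
have PD : P D = q%:E.
  rewrite -(prob_traj init_pmf p_pmf Y_chain n.+1 (fun h => last x h == x)).
  by congr (P _); apply/seteqP; split=> w;
    rewrite /D /mkset trajS last_rcons => /eqP.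
pose avg k w := (\sum_(t < k) f (Y t w)) / k%:R.
have sum_traj k w : \sum_(t < k) f (Y t w) = \sum_(z <- traj Y k w) f z.
  by rewrite -(big_mkord xpredT (fun t => f (Y t w))) /index_iota subn0 /traj big_map.
have avg01 k w : 0 <= avg k w <= 1.
  have s0 : 0 <= \sum_(t < k) f (Y t w) by apply: sumr_ge0 => t _; case/andP: (f01 (Y t w)).
  rewrite /avg divr_ge0 //=; case: k s0 => [|k] _; first by rewrite invr0 mulr0.
  rewrite ler_pdivrMr // mul1r.
  have -> : k.+1%:R = \sum_(t < k.+1) 1 :> R by rewrite sumr_const card_ord.
  by apply: ler_sum => t _; case/andP: (f01 (Y t w)).
have mavg k : measurable_fun setT (fun w => (avg k w)%:E : \bar R).
  apply/measurable_EFinP; rewrite /avg.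
  under eq_fun do rewrite sum_traj.
  exact: (measurable_fun_traj Y_chain k (fun h => (\sum_(z <- h) f z) / k%:R)).
have cvgI : (fun k => \int[P]_(w in D) (avg k w)%:E)%E @ \oo --> (m * q)%:E.
  have := @dominated_convergence _ _ _ P D mD (fun k w => (avg k w)%:E)
    (cst m%:E) (cst 1%E) (fun k => measurable_funS measurableT (@subsetT _ _) (mavg k))
    (measurable_cst _).
  rewrite integral_cst // -[X in (_ * X)%E]/(P D) PD => DC; apply: (fun A B C => let: And3 _ _ c := DC A B C in c).
  - case: Hm => A [mA PA sA]; exists A; split => // w /= nw; apply: sA => /= H.
    by apply: nw => _; apply: cvg_EFin => //; exact: nearW.
  - apply/integrableP; split; first exact: measurable_cst.
    under eq_integral do rewrite /= normr1.
    by rewrite integral_cst // mul1e -[X in (X < _)%E]/(P D) PD ltry.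
  - apply: aeW => w k _; rewrite lee_fin ger0_norm; by case/andP: (avg01 k w).
have intE k : (\int[P]_(w in D) (avg (n.+1 + k) w)%:E)%E =
    (path_ev init p (n.+1 + k)
     (fun h => (last x (take n.+1 h) == x)%:R * \sum_(z <- h) f z) [::] / (n.+1 + k)%:R)%:E.
  set g := (fun h : seq E => _).
  transitivity (\int[P]_w ((g (traj Y (n.+1 + k) w)) / (n.+1 + k)%:R)%:E)%E.
    rewrite integral_mkcond; apply: eq_integral => w _.
    rewrite patchE /g -sum_traj -mulrA -/(avg _ _).
    have -> : take n.+1 (traj Y (n.+1 + k) w) = traj Y n.+1 w.
      by rewrite /traj /mkseq -map_take take_iota (minn_idPl (leq_addr _ _)).
    rewrite trajS last_rcons; case: ifPn => [|].
      by rewrite inE => ->; rewrite eqxx mul1r.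
    by rewrite notin_setE => /eqP/negPf ->; rewrite mul0r.
  rewrite (integral_traj init_pmf p_pmf Y_chain _ (g := fun h => g h / (n.+1 + k)%:R)).
    congr (_%:E).
    transitivity (path_ev init p (n.+1 + k) (fun h => (n.+1 + k)%:R^-1 * g h + 0 * 0) [::]).
      by apply: eq_path_ev => // s _; rewrite mul0r addr0 mulrC.
    by rewrite path_ev_lin mul0r addr0 mulrC.
  move=> h; rewrite divr_ge0 // mulr_ge0 //.
  by apply: sumr_ge0 => z _; case/andP: (f01 z).
pose J k := path_ev init p (n.+1 + k)
     (fun h => (last x (take n.+1 h) == x)%:R * \sum_(z <- h) f z) [::].
have {}cvgI : (J k / (n.+1 + k)%:R) @[k --> \oo] --> m * q.
  have : ((J k / (n.+1 + k)%:R)%:E @[k --> \oo] --> (m * q)%:E)%E.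
    rewrite -(cvg_shiftn n.+1) in cvgI; move: cvgI; apply: cvg_trans.
    by apply: near_eq_cvg; apply: nearW => k /=; rewrite addnC intE.
  by case/fine_cvgP.
have eq0 : 0 < e * q / 4 by rewrite divr_gt0 // mulr_gt0.
have near1 : \forall k \near \oo, `|J k / (n.+1 + k)%:R - m * q| <= e * q / 4.
  by have /cvgrPdist_le/(_ _ eq0) := cvgI; apply: filterS => k; rewrite distrC.
near=> k.
have Hk : `|J k / (n.+1 + k)%:R - m * q| <= e * q / 4 by near: k.
have kn : n.+1%:R <= k%:R :> R by rewrite ler_nat; near: k; exact: nbhs_infty_ge.
(* The boundary terms take half of the allowance [k * (e * q)]; the other half covers [e * q / 4]
   times [n.+1 + k], as [n.+1 <= k]. *)
have kM : n.+1%:R * (1 + `|m * q|) <= k%:R * (e * q / 2).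
  rewrite -ler_pdivrMr ?divr_gt0 ?mulr_gt0 //; near: k; exact: nbhs_infty_ger.
have /andP[J1 J2] := @occupation_visit f n k x q (J k) f01 erefl erefl.
rewrite -/q -/(J k) in J1 J2; set o := occupation p k f x in J1 J2 *.
have nk0 : 0 < (n.+1 + k)%:R :> R by rewrite ltr0n.
have {}Hk : `|J k - m * q * (n.+1 + k)%:R| <= e * q / 4 * (n.+1 + k)%:R.
  have -> : J k - m * q * (n.+1 + k)%:R = (J k / (n.+1 + k)%:R - m * q) * (n.+1 + k)%:R.
    by rewrite mulrBl divfK // gt_eqF.
  by rewrite normrM (gtr0_norm nk0) ler_wpM2r // ltW.
rewrite -(ler_pM2l q0) -{1}(gtr0_norm q0) -normrM.
move: Hk kM; rewrite natrD.
set a := n.+1%:R in kn J2 *; set b := k%:R in kn *; set mq := m * q.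
have -> : q * (o - b * m) = q * o - b * mq by rewrite /mq; ring.
have a0 : 0 <= a by rewrite /a.
have b0 : 0 <= b by rewrite /b.
have h1 : - `|mq| <= mq <= `|mq| by rewrite -ler_norml.
have h3 : `|a * mq| <= a * `|mq| by rewrite normrM (ger0_norm a0).
have h4 : e * q / 4 * a <= e * q / 4 * b by rewrite ler_wpM2l // ltW.
move: h3; rewrite !ler_norml => /andP[? ?] /andP[? ?] ?; apply/andP; split; lra.
Unshelve. all: by end_near.
Qed.

End Ergodic.

(** * Convergence in law under scaling and vanishing perturbations *)

Section ConvergenceInLaw.
Set Implicit Arguments.
Unset Strict Implicit.
Local Open Scope classical_set_scope.
Variable R : realType.

(** A monotone function has countably many discontinuities, whereas the interval has positive
    Lebesgue measure. *)
Lemma nondecreasing_continuity_point (F : R -> R) (a b : R) :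
  {homo F : x y / x <= y} -> a < b ->
  exists2 x, a < x < b & {for x, continuous F}.
Proof.
move=> ndF ab.
have ndF' : {in `[a, b]%R &, nondecreasing_fun F} by move=> x y _ _; exact: ndF.
have [x [axb ndx]] : exists x, a < x < b /\ ~ discontinuity F x.
  apply: contrapT => H.
  have /countable_lebesgue_measure0 := discontinuity_countable ndF'.
  rewrite (_ : [set x | _] = [set` `]a, b[%R]).
    rewrite lebesgue_measure_itv /= lte_fin ab -EFinB => -[] /eqP.
    by rewrite subr_eq0 gt_eqF.
  apply/seteqP; split=> x /=; first by case.
  move=> xab; split=> //; apply: contrapT => nd; apply: H; exists x; split=> //.
exists x => //; case/andP: axb => ax xb.
(* So far only the equality of the one-sided limits is known; monotonicity makes them exist and
   squeezes [F x] between them. *)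
have cvl : cvg (F y @[y --> x^'-]).
  apply: nondecreasing_at_left_is_cvgr.
    by apply: nearW => z u v _ _; exact: ndF.
  apply: nearW => z; exists (F x) => _ [u /= + <-].
  by rewrite in_itv /= => /andP[_ /ltW]; exact: ndF.
have cvr : cvg (F y @[y --> x^'+]).
  apply: nondecreasing_at_right_is_cvgr.
    by apply: nearW => z u v _ _; exact: ndF.
  apply: nearW => z; exists (F x) => _ [u /= + <-].
  by rewrite in_itv /= => /andP[/ltW + _]; exact: ndF.
have lelr : lim (F y @[y --> x^'-]) = lim (F y @[y --> x^'+]).
  by apply: contrapT => /eqP ne; apply: ndx.
have le1 : lim (F y @[y --> x^'-]) <= F x.
  apply: limr_le => //; near=> y; apply: ndF; apply: ltW; near: y.
  exact: nbhs_left_lt.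
have le2 : F x <= lim (F y @[y --> x^'+]).
  apply: limr_ge => //; near=> y; apply: ndF; apply: ltW; near: y.
  exact: nbhs_right_gt.
have E : lim (F y @[y --> x^'-]) = F x by apply/eqP; rewrite eq_le le1 lelr.
by apply/left_right_continuousP; split; [rewrite -E|rewrite -E lelr].
Unshelve. all: by end_near. Qed.

Variables (d : measure_display) (T : measurableType d) (P : probability T R).

Lemma measurable_scale (a : R) :
  @measurable_fun _ _ (measurableTypeR R) (measurableTypeR R) setT ( *%R a).
Proof. exact: mulrl_measurable. Qed.

Definition scaled_law (L : probability (measurableTypeR R) R) (a : R) :
    probability (measurableTypeR R) R :=
  distribution L
    (@mfun_Sub _ _ (measurableTypeR R) (measurableTypeR R) _ (mem_set (measurable_scale a))).

Lemma scaled_lawE L (a y : R) :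
  scaled_law L a [set z | z <= y] = L [set z | a * z <= y].
Proof. by []. Qed.

Lemma scaled_law_second_moment L (a : R) :
  (\int[scaled_law L a]_x (x ^+ 2)%:E = (a ^+ 2)%:E * \int[L]_x (x ^+ 2)%:E)%E.
Proof.
have msq : @measurable_fun _ _ (measurableTypeR R) (\bar R) setT
    (fun x : measurableTypeR R => ((x : R) ^+ 2)%:E).
  by apply/measurable_EFinP; exact: measurable_funX.
rewrite /scaled_law ge0_integral_distribution //; last first.
  by move=> y; rewrite lee_fin sqr_ge0.
rewrite -ge0_integralZl_EFin ?sqr_ge0 //; last by move=> y _; rewrite lee_fin sqr_ge0.
by apply: eq_integral => x _ /=; rewrite exprMn EFinM.
Qed.

(** Slutsky's argument: choose continuity points [t1 < x / a < t2] of [G] close to [x / a]. The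
    probability of [Z n <= x] lies between those of [W n <= t1] and [W n <= t2], up to the
    probability that [e n] exceeds a fixed positive size. *)
Lemma cvg_in_law_scale_perturb (W Z e : nat -> T -> R) (a : R)
    (L : probability (measurableTypeR R) R) :
  0 < a -> (forall n w, Z n w = a * W n w + e n w) ->
  (forall n x, measurable [set w | W n w <= x]) ->
  (forall n x, measurable [set w | Z n w <= x]) ->
  (forall n x, measurable [set w | x <= `|e n w|]) ->
  (forall eta : R, 0 < eta -> P [set w | eta <= `|e n w|] @[n --> \oo] --> 0%E) ->
  cvg_in_law P W L -> cvg_in_law P Z (scaled_law L a).
Proof.
move=> a0 ZE mW mZ me e_cvg WL x contx.
pose pr (A : set T) := fine (P A).
have prE A : measurable A -> P A = (pr A)%:E by move=> mA; rewrite fineK // fin_num_measure.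
pose G (y : R) : R := fine (L [set z | z <= y]).
have mle (y : R) : measurable ([set z | z <= y] : set (measurableTypeR R)).
  by rewrite (_ : [set z | z <= y] = `]-oo, y]%classic) //; apply/seteqP; split=> z;
    rewrite /= in_itv.
have GE (y : R) : L [set z | z <= y] = (G y)%:E by rewrite fineK // fin_num_measure.
have ndG : {homo G : y z / y <= z}.
  move=> y z yz; rewrite -lee_fin -!GE le_measure ?inE //.
  by move=> t /= /le_trans; apply.
have pr_le A B C : measurable A -> measurable B -> measurable C ->
    A `<=` B `|` C -> pr A <= pr B + pr C.
  move=> mA mB mC sub; rewrite -lee_fin EFinD -!prE //.
  apply: le_trans (measureU2 P mB mC).
  by apply: le_measure; rewrite ?inE //; exact: measurableU.
have scE (y : R) : scaled_law L a [set z | z <= y] = (G (y / a))%:E.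
  rewrite scaled_lawE -GE; congr (L _); apply/seteqP; split=> z /=;
  by rewrite ler_pdivlMr // mulrC.
have {}contx : {for x, continuous (fun y : R => G (y / a))}.
  have : (G (y / a))%:E @[y --> x] --> (G (x / a))%:E.
    by rewrite -scE; under eq_fun do rewrite -scE; exact: contx.
  by case/fine_cvgP.
have WG (y : R) : {for y, continuous G} -> pr [set w | W n w <= y] @[n --> \oo] --> G y.
  move=> cG; have /WL : {for y, continuous (fun y : R => L [set z | z <= y])}.
    rewrite (_ : (fun y => _) = EFin \o G); last by apply/funext => z; rewrite GE.
    by apply: cvg_EFin => //; exact: nearW.
  by rewrite GE => /fine_cvgP[].
have prZ n : P [set w | Z n w <= x] = (pr [set w | Z n w <= x])%:E by apply: prE.
rewrite scE; under eq_fun do rewrite prZ.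
apply: cvg_EFin; first exact: nearW.
apply/cvgrPdist_le => eps eps0.
have eps4 : 0 < eps / 4 by rewrite divr_gt0.
have /cvgrPdist_lt/(_ _ eps4) := contx; case=> dl /= dl0 Hdl.
have a_dl : 0 < dl / a by rewrite divr_gt0.
have Gnear y : `|x / a - y| < dl / a -> `|G (x / a) - G y| < eps / 4.
  move=> Hy; have := Hdl (y * a); rewrite mulfK ?gt_eqF //; apply.
  rewrite /=; have -> : x - y * a = (x / a - y) * a by rewrite mulrBl divfK // gt_eqF.
  by rewrite normrM (gtr0_norm a0) -ltr_pdivlMr.
have [t1 /andP[t1l t1r] ct1] : exists2 t, x / a - dl / a < t < x / a & {for t, continuous G}.
  by apply: nondecreasing_continuity_point => //; rewrite gtrBl.
have [t2 /andP[t2l t2r] ct2] : exists2 t, x / a < t < x / a + dl / a & {for t, continuous G}.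
  by apply: nondecreasing_continuity_point => //; rewrite ltrDl.
have G1 : `|G (x / a) - G t1| < eps / 4.
  by apply: Gnear; rewrite ltr_norml; apply/andP; split; lra.
have G2 : `|G (x / a) - G t2| < eps / 4.
  by apply: Gnear; rewrite ltr_norml; apply/andP; split; lra.
have e_small eta : 0 < eta -> \forall n \near \oo, pr [set w | eta <= `|e n w|] <= eps / 4.
  move=> /e_cvg; rewrite -[0%E]/(0%:E) => /fine_cvgP[_ /cvgrPdist_le/(_ _ eps4)].
  by apply: filterS => n; rewrite sub0r normrN; apply: le_trans; rewrite ler_norm.
have eta1 : 0 < a * (x / a - t1) by rewrite mulr_gt0 // subr_gt0.
have eta2 : 0 < a * (t2 - x / a) by rewrite mulr_gt0 // subr_gt0.
near=> n.
have N1 : `|G t1 - pr [set w | W n w <= t1]| <= eps / 4.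
  by near: n; have /cvgrPdist_le/(_ _ eps4) := WG _ ct1.
have N2 : `|G t2 - pr [set w | W n w <= t2]| <= eps / 4.
  by near: n; have /cvgrPdist_le/(_ _ eps4) := WG _ ct2.
have N3 : pr [set w | a * (x / a - t1) <= `|e n w|] <= eps / 4 by near: n; exact: e_small.
have N4 : pr [set w | a * (t2 - x / a) <= `|e n w|] <= eps / 4 by near: n; exact: e_small.
have ax : a * (x / a) = x by rewrite mulrC divfK // gt_eqF.
have U : pr [set w | Z n w <= x] <=
    pr [set w | W n w <= t2] + pr [set w | a * (t2 - x / a) <= `|e n w|].
  apply: pr_le => // w /=; rewrite ZE mulrBr ax => Zx.
  have [We|We] := leP (W n w) t2; [by left|right].
  have : a * t2 < a * W n w by rewrite ltr_pM2l.
  have : - e n w <= `|e n w| by rewrite -normrN ler_norm.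
  lra.
have D : pr [set w | W n w <= t1] <=
    pr [set w | Z n w <= x] + pr [set w | a * (x / a - t1) <= `|e n w|].
  apply: pr_le => // w /=; rewrite ZE mulrBr ax => Wt.
  have [We|We] := leP (a * W n w + e n w) x; [by left|right].
  have : a * W n w <= a * t1 by rewrite ler_pM2l.
  have : e n w <= `|e n w| by rewrite ler_norm.
  lra.
move: G1 G2 N1 N2; rewrite !ltr_norml !ler_norml.
move=> /andP[? ?] /andP[? ?] /andP[? ?] /andP[? ?]; apply/andP; split; lra.
Unshelve. all: by end_near. Qed.

End ConvergenceInLaw.

(** * The policy as a process *)

Section PolicyProcess.
Set Implicit Arguments.
Unset Strict Implicit.
Local Open Scope classical_set_scope.
Variables (R : realType) (N : nat) (E : finType) (init : E -> R) (p : E -> E -> R).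
Variable chan : E -> chan_state N.
Variables (d : measure_display) (T : measurableType d) (P : probability T R).
Variables (Y : nat -> T -> E) (mu c : 'I_N -> R).
Hypothesis Y_chain : markov_chain init p P Y.

Definition deficit_policy : policy R N := fun h x a => (a == serve mu c h x)%:R.

Lemma deficit_policy_is_policy : is_policy deficit_policy.
Proof.
move=> h x; split.
- split=> [a|]; first by rewrite ler0n.
  rewrite (bigD1 (serve mu c h x)) //= /deficit_policy eqxx big1 ?addr0 // => a.
  by move=> /negPf ->.
- move=> i xi; rewrite /deficit_policy; case: serveP => [k xk _|//].
  case: eqP => // -[ik]; by rewrite ik xk in xi.
- move=> [i xi]; rewrite /deficit_policy; case: serveP => [//|x0].
  by have := x0 i; rewrite xi.
Qed.

Definition channels n w : seq (chan_state N) := map chan (traj Y n w).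

Definition decision t w : option 'I_N :=
  serve mu c (serve_history mu c (channels t w)) (chan (Y t w)).

Lemma channelsS n w : channels n.+1 w = rcons (channels n w) (chan (Y n w)).
Proof. by rewrite /channels trajS map_rcons. Qed.

(** If the prescribed decisions are those of the policy along [y], every policy factor is 1 and the
    event is a cylinder of the chain. Otherwise the event is empty and some factor is 0. *)
Lemma decision_runs : runs_policy init p chan deficit_policy P Y decision.
Proof.
split; first exact: Y_chain.1.
  move=> t a.
  pose f (h : seq E) :=
    (last ([ffun=> false] : chan_state N, None) (serve_history mu c (map chan h))).2.
  rewrite (_ : _ @^-1` _ = [set w | f (traj Y t.+1 w) = a]).
    exact: measurable_traj Y_chain t.+1 (fun h => f h = a).
  apply/seteqP; split=> w; rewrite /preimage /mkset /f -/(channels t.+1 w) channelsS;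
    by rewrite serve_history_rcons last_rcons.
move=> n y a.
pose ch := chan \o y.
pose dec t := serve mu c (serve_history mu c (mkseq ch t)) (chan (y t)).
have histE t : (forall s, (s < t)%N -> a s = dec s) ->
    serve_history mu c (mkseq ch t) = [seq (chan (y s), a s) | s <- iota 0 t].
  elim: t => // t IH Ha; rewrite mkseqS serve_history_rcons -addn1 iotaD map_cat /= add0n cats1.
  by rewrite -IH => [|s st]; [rewrite Ha | apply: Ha; exact: leqW].
have decE w t : (forall s, (s <= t)%N -> Y s w = y s) -> decision t w = dec t.
  move=> HY; rewrite /decision /dec HY //; congr (serve _ _ (serve_history _ _ _) _).
  rewrite /channels /traj /mkseq -map_comp; apply/eq_in_map => s.
  by rewrite mem_iota add0n => /andP[_ st] /=; rewrite HY // ltnW.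
have [consistent|inconsistent] := pselect (forall t, (t <= n)%N -> a t = dec t).
  rewrite [X in _ * X]big1 ?mulr1; last first.
    move=> t _; rewrite /deficit_policy -histE.
      by rewrite consistent ?eqxx // -ltnS.
    by move=> s st; apply: consistent; rewrite ltnW // (leq_trans st) // -ltnS.
  rewrite -Y_chain.2; congr (P _); apply/seteqP; split=> w /= H t tn; first by case: (H t tn).
  split; first exact: H.
  by rewrite (decE w) ?consistent // => s st; apply: H; exact: leq_trans tn.
rewrite (_ : [set w | _] = set0); last first.
  apply/seteqP; split=> // w /= H; apply: inconsistent => t tn.
  rewrite -(H t tn).2; apply: decE => s st; by case: (H s (leq_trans st tn)).
rewrite measure0; set pr := \prod_(t < n.+1) _.
suff -> : pr = 0 by rewrite mulr0.
(* A factor is evaluated at the prescribed past, which is the replayed one only if all earlier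
   decisions agree; hence the strong induction. *)
apply/eqP; apply: contraT => /prodf_neq0 pr0; case: inconsistent.
move=> t; elim/ltn_ind: t => t IH tn.
have tn1 : (t < n.+1)%N by rewrite ltnS.
have := pr0 (Ordinal tn1) isT; rewrite /deficit_policy /= -histE.
  by rewrite pnatr_eq0 eqb0 negbK => /eqP.
by move=> s st; apply: IH => //; exact: leq_trans (ltnW st) tn.
Qed.

Lemma sum_deliveries n w i :
  \sum_(t < n) (delivery decision i t w)%:R =
  n%:R * mu i - path_deficit mu c (channels n w) i.
Proof.
elim: n => [|n IH].
  by rewrite big_ord0 /channels /path_deficit /deficit /=; rewrite !mul0r !subr0.
rewrite big_ord_recr /= IH channelsS path_deficit_rcons /delivery /decision /served.
by rewrite -(addn1 n) natrD; ring.
Qed.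

Lemma sum_chan_max n w :
  \sum_(t < n) (chan_max [set: 'I_N]%SET (chan (Y t w)))%:R =
  n%:R * (\sum_i mu i) - total_deficit mu c (channels n w).
Proof.
elim: n => [|n IH].
  rewrite big_ord0 mul0r /channels /total_deficit /= big1 ?subr0 // => i _.
  by rewrite /path_deficit /deficit /= mul0r subr0.
rewrite big_ord_recr /= IH channelsS total_deficit_rcons.
by rewrite -(addn1 n) natrD; ring.
Qed.

Lemma path_deficitE s i : 0 < c i ->
  path_deficit mu c s i =
  c i * imbalance mu c s i + c i / total_weight c * total_deficit mu c s.
Proof.
move=> ci; rewrite /imbalance mulrBr mulrCA mulfV ?gt_eqF // mulr1.
by ring.
Qed.

End PolicyProcess.

(** * State-space collapse *)

Section Collapse.
Set Implicit Arguments.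
Unset Strict Implicit.
Local Open Scope classical_set_scope.
Variables (R : realType) (N : nat) (E : finType) (init : E -> R) (p : E -> E -> R).
Variable chan : E -> chan_state N.
Variables (d : measure_display) (T : measurableType d) (P : probability T R).
Variables (Y : nat -> T -> E) (mu c : 'I_N -> R).
Hypothesis init_pmf : is_pmf init.
Hypothesis p_pmf : forall x, is_pmf (p x).
Hypothesis Y_chain : markov_chain init p P Y.
Hypothesis c_gt0 : forall i, 0 < c i.
Variable C : R.

Let V h : R := lyapunov mu c (map chan h).

Hypothesis V_linear : forall n, path_ev init p n (fun h => V h ^+ 2) [::] <= C * n.+1%:R.

Let s n w := channels chan Y n w.

(** Markov's inequality. *)
Let sqr_lyapunov_tail n (k : R) : 0 < k ->
  (P [set w | (k <= lyapunov mu c (s n w) ^+ 2)%R] <= (C * n.+1%:R / k)%:E)%E.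
Proof.
move=> k0; rewrite (prob_traj init_pmf p_pmf Y_chain n (fun h => k <= V h ^+ 2)) lee_fin.
apply: (@le_trans _ _ (path_ev init p n (fun h => k^-1 * V h ^+ 2 + 0 * 0) [::])).
  apply: path_ev_le => // h _; rewrite cat0s mul0r addr0 [k^-1 * _]mulrC.
  case: (leP k (V h ^+ 2)) => [kV|_]; first by rewrite ler_pdivlMr // mul1r.
  by rewrite divr_ge0 ?sqr_ge0 // ltW.
by rewrite path_ev_lin mul0r addr0 mulrC ler_pM2r ?invr_gt0.
Qed.

Lemma imbalance_sqr_le h i : (c i * imbalance mu c h i ^+ 2) ^+ 2 <= lyapunov mu c h ^+ 2.
Proof.
have ci2 : 0 <= c i * imbalance mu c h i ^+ 2 by rewrite mulr_ge0 ?sqr_ge0 // ltW.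
rewrite lerXn2r ?nnegrE ?lyapunov_ge0 // /lyapunov (bigD1 i) //= lerDl.
by apply: sumr_ge0 => k _; rewrite mulr_ge0 ?sqr_ge0 // ltW.
Qed.

Let C_ge0 : 0 <= C.
Proof.
have := V_linear 0; rewrite mulr1; apply: le_trans.
by rewrite /= sqr_ge0.
Qed.

(** The event forces [eta ^+ 2 * n / c i <= V], that is [k * n ^+ 2 <= V ^+ 2], whose probability is
    at most [C * (n + 1) / (k * n ^+ 2)]. *)
Lemma imbalance_negligible_in_probability i (eta : R) : 0 < eta ->
  P [set w | eta <= `|- (c i * imbalance mu c (s n w) i) / Num.sqrt n%:R|]
    @[n --> \oo] --> 0%E.
Proof.
move=> eta0; have ci := c_gt0 i; have C0 := C_ge0.
pose k := (eta ^+ 2 / c i) ^+ 2.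
have k0 : 0 < k by rewrite exprn_gt0 // divr_gt0 // exprn_gt0.
apply: (@squeeze_cvge _ _ _ _ (cst 0%E) _ (fun n => (C * 2 / k / n%:R)%:E)); last 2 first.
- exact: cvg_cst.
- apply: cvg_EFin; first exact: nearW.
  rewrite -[0]/(fine 0%E) /= -(mulr0 (C * 2 / k)).
  by apply: cvgMr; apply/gtr0_cvgV0; [near=> n; rewrite ltr0n; near: n; exact: nbhs_infty_gt
    | exact: cvgr_idn].
near=> n; rewrite measure_ge0 /=.
have n0 : (0 < n)%N by near: n; exact: nbhs_infty_gt.
have nR : 0 < n%:R :> R by rewrite ltr0n.
apply: (@le_trans _ _ (P [set w | k * n%:R ^+ 2 <= lyapunov mu c (s n w) ^+ 2])).
  apply: le_measure; rewrite ?inE.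
  - exact: measurable_traj Y_chain n (fun h => eta <=
      `|- (c i * imbalance mu c (map chan h) i) / Num.sqrt n%:R|).
  - exact: measurable_traj Y_chain n (fun h => k * n%:R ^+ 2 <= V h ^+ 2).
  move=> w /=; set u := imbalance _ _ _ _ => H.
  apply: le_trans (imbalance_sqr_le _ i); rewrite -/u.
  have : eta ^+ 2 <= (c i * u) ^+ 2 / n%:R.
    have := lerXn2r 2 _ _ H; rewrite !nnegrE (ltW eta0) normr_ge0 => /(_ isT isT).
    by rewrite real_normK ?num_real // exprMn sqrrN exprVn sqr_sqrtr.
  rewrite ler_pdivlMr // => Hu.
  rewrite /k -exprMn lerXn2r ?nnegrE //.
  - by rewrite mulr_ge0 // divr_ge0 ?sqr_ge0 // ltW.
  - by rewrite mulr_ge0 ?sqr_ge0 // ltW.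
  rewrite mulrAC ler_pdivrMr //; apply: le_trans Hu _.
  by rewrite le_eqVlt; apply/orP; left; apply/eqP; ring.
apply: le_trans (sqr_lyapunov_tail n _) _; first by rewrite mulr_gt0 // exprn_gt0.
rewrite lee_fin.
have -> : C * 2 / k / n%:R = C * (2 * n%:R) / (k * n%:R ^+ 2).
  by field; rewrite !gt_eqF.
have kn0 : 0 < k * n%:R ^+ 2 by rewrite mulr_gt0 // exprn_gt0.
rewrite ler_pM2r ?invr_gt0 //; apply: ler_wpM2l => //.
by rewrite -natrM ler_nat; lia.
Unshelve. all: by end_near. Qed.

(** Almost surely [V ^+ 2 < n ^+ 3] for all large [n], by Borel-Cantelli, so the imbalance is of
    order at most [n] to the power 3/4. *)
Lemma imbalance_negligible_ae i :
  {ae P, forall w, imbalance mu c (s n w) i / n%:R @[n --> \oo] --> (0 : R)}.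
Proof.
have C0 := C_ge0; have ci := c_gt0 i.
pose F n := [set w | n.+1%:R ^+ 3 <= lyapunov mu c (s n.+1 w) ^+ 2].
have mF n : measurable (F n).
  exact: measurable_traj Y_chain n.+1 (fun h => n.+1%:R ^+ 3 <= V h ^+ 2).
(* This form is chosen because the sum telescopes to [4 * C * (1 - n.+1%:R^-1)]. *)
have PF n : (P (F n) <= (4 * C / (n.+1%:R * n.+2%:R))%:E)%E.
  apply: le_trans (sqr_lyapunov_tail n.+1 _) _; first by rewrite exprn_gt0.
  rewrite lee_fin.
  have n1 : 1 <= n.+1%:R :> R by rewrite ler1n.
  rewrite -[n.+2]addn1 natrD; move: (n.+1%:R) n1 => x x1.
  have x0 : 0 < x by apply: lt_le_trans x1.
  have x10 : 0 < x + 1 by apply: addr_gt0.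
  rewrite ler_pdivrMr ?exprn_gt0 // mulrAC ler_pdivlMr ?mulr_gt0 //.
  have : (x + 1) * (x * (x + 1)) <= 4 * x ^+ 3 by nra.
  by move=> /(ler_wpM2l C0); rewrite !mulrA (mulrC 4).
have sumF : (\sum_(n <oo) P (F n) < +oo)%E.
  apply: (@le_lt_trans _ _ (4 * C)%:E); last exact: ltry.
  apply: lime_le; first by apply: is_cvg_nneseries.
  apply: nearW => n.
  apply: (@le_trans _ _ (4 * C * (1 - n.+1%:R^-1))%:E); last first.
    by rewrite lee_fin -[X in _ <= X]mulr1 ler_wpM2l ?mulr_ge0 // gerBl invr_ge0.
  elim: n => [|n IH]; first by rewrite big_geq // invr1 subrr mulr0.
  rewrite big_nat_recr //=; apply: le_trans (leeD IH (PF n)) _.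
  rewrite -EFinD lee_fin le_eqVlt; apply/orP; left; apply/eqP.
  rewrite -[n.+2]addn1 natrD.
  have n1 : n.+1%:R != 0 :> R by rewrite pnatr_eq0.
  have n2 : n.+1%:R + 1 != 0 :> R by rewrite natr1 pnatr_eq0.
  by move: (n.+1%:R) n1 n2 => x n1 n2; field; rewrite n1 n2.
exists (lim_sup_set F); split.
- by apply: bigcap_measurable => // n _; apply: bigcup_measurable.
- exact: lim_sup_set_cvg0.
move=> w /= Hw; apply: contrapT => nlim; apply: Hw.
have [n0 Hn0] : exists n0, forall n, (n0 <= n)%N -> ~ F n w.
  apply: contrapT => H; apply: nlim => n _; apply: contrapT => H'; apply: H.
  by exists n => k nk Fk; apply: H'; exists k.
apply/cvgrPdist_lt => eps eps0.
near=> n.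
have nn0 : (n0.+1 <= n)%N by near: n; exact: nbhs_infty_ge.
(* If the imbalance were at least [eps * n], then [c i ^+ 2 * eps ^+ 4 * n ^+ 4 < n ^+ 3],
   contradicting this choice of [n]. *)
have nbig : (eps ^+ 4 * c i ^+ 2)^-1 < n%:R by near: n; exact: nbhs_infty_gtr.
have n_gt0 : (0 < n)%N := leq_ltn_trans (leq0n _) nn0.
have := Hn0 n.-1; rewrite -ltnS /F /mkset prednK // => /(_ nn0) /negP.
rewrite -ltNge => HV.
have := le_lt_trans (imbalance_sqr_le (s n w) i) HV.
set u := imbalance _ _ _ _ => Hu; rewrite sub0r normrN ltNge; apply/negP => He.
have x0 : 0 < n%:R :> R by rewrite ltr0n.
move: nbig Hu He; move: (n%:R) x0 => x x0 xbig Hu.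
rewrite normrM (gtr0_norm (_ : 0 < x^-1)) ?invr_gt0 // ler_pdivlMr // => He.
have : (eps * x) ^+ 4 <= u ^+ 4.
  have -> : u ^+ 4 = `|u| ^+ 4 by rewrite (exprM u 2 2) (exprM `|u| 2 2) real_normK ?num_real.
  by rewrite lerXn2r ?nnegrE // mulr_ge0 // ltW.
have : 1 < x * (eps ^+ 4 * c i ^+ 2).
  by rewrite -ltr_pdivrMr ?mulr_gt0 ?exprn_gt0 // mul1r.
have x30 : 0 < x ^+ 3 by rewrite exprn_gt0.
have c20 : 0 < c i ^+ 2 by rewrite exprn_gt0.
rewrite -(ltr_pM2l x30) mulr1 => H1 /(ler_wpM2l (ltW c20)) H2.
have : x ^+ 3 < x ^+ 3.
  apply: lt_le_trans H1 _; apply: le_trans (ltW Hu).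
  have -> : (c i * u ^+ 2) ^+ 2 = c i ^+ 2 * u ^+ 4 by ring.
  by apply: le_trans H2; rewrite le_eqVlt; apply/orP; left; apply/eqP; ring.
by rewrite ltxx.
Unshelve. all: by end_near. Qed.

End Collapse.

(** * Achievability *)

Section Achievability.
Set Implicit Arguments.
Unset Strict Implicit.
Local Open Scope classical_set_scope.

(** A minimum over finitely many positive gaps; the cap 1 keeps it positive when there is no
    nonempty proper subset. *)
Lemma uniform_slack (R : realType) (N : nat) (mu : 'I_N -> R) (m : {set 'I_N} -> R) :
  (forall S : {set 'I_N}, S != finset.set0 -> S \proper [set: 'I_N]%SET ->
     \sum_(i in S) mu i < m S) ->
  exists2 delta, 0 < delta & forall S : {set 'I_N}, S != finset.set0 ->
    S \proper [set: 'I_N]%SET -> \sum_(i in S) mu i + 2 * delta <= m S.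
Proof.
move=> slack.
pose proper_set (S : {set 'I_N}) := (S != finset.set0) && (S \proper [set: 'I_N]%SET).
pose gap (S : {set 'I_N}) := m S - \sum_(i in S) mu i.
pose g := \big[Num.min/1]_(S : {set 'I_N} | proper_set S) gap S.
exists (g / 2).
  rewrite divr_gt0 // lt_bigmin ?ltr01 // => S /andP[S0 Sp].
  by rewrite subr_gt0 slack.
move=> S S0 Sp; rewrite mulrC divfK ?pnatr_eq0 //.
have : g <= gap S by apply: bigmin_le_cond; rewrite /proper_set S0 Sp.
by rewrite /gap; lra.
Qed.

(** There are finitely many pairs of a starting state and a subset, so one block length serves them
    all. *)
Lemma near_block_length (R : realType) (N : nat) (E : finType) (init : E -> R)
    (p : E -> E -> R) (chan : E -> chan_state N) (d : measure_display)
    (T : measurableType d) (P : probability T R) (Y : nat -> T -> E)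
    (m : {set 'I_N} -> R) (e : R) :
  is_pmf init -> (forall x, is_pmf (p x)) -> irreducible_chain p ->
  markov_chain init p P Y ->
  (forall S, has_mean P (fun t w => chan_max S (chan (Y t w))) (m S)) -> 0 < e ->
  exists2 K, (0 < K)%N & forall x (S : {set 'I_N}),
    `|occupation p K (fun z => (chan_max S (chan z))%:R) x - K%:R * m S| <= K%:R * e.
Proof.
move=> init_pmf p_pmf irr Y_chain means e0.
have near_all : \forall k \near \oo, forall q : E * {set 'I_N},
    `|occupation p k (fun z => (chan_max q.2 (chan z))%:R) q.1 - k%:R * m q.2| <= k%:R * e.
  apply: filter_forall => -[x S] /=.
  apply: (occupation_average init_pmf p_pmf irr Y_chain _ _ (means S)) => // z.
  by rewrite chan_maxE; case: [exists _ in _, _]; rewrite ?lexx ?ler01.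
have [K [HK K0]] : exists K, (forall q : E * {set 'I_N},
    `|occupation p K (fun z => (chan_max q.2 (chan z))%:R) q.1 - K%:R * m q.2| <= K%:R * e)
     /\ (0 < K)%N.
  near \oo => K; exists K; split; near: K; [exact: near_all|exact: nbhs_infty_gt].
by exists K => // x S; exact: (HK (x, S)).
Unshelve. all: by end_near. Qed.

End Achievability.

Theorem theorem3 (R : realType) (N : nat)
  (E : finType) (init : E -> R) (p : E -> E -> R) (chan : E -> chan_state N)
  (d : measure_display) (T : measurableType d) (P : probability T R)
  (Y : nat -> T -> E)
  (m v2 : {set 'I_N} -> R) (mu sigma2 : 'I_N -> R)
  (init_pmf : is_pmf init) (p_stochastic : forall x, is_pmf (p x))
  (p_irreducible : irreducible_chain p) (p_recurrent : positive_recurrent p)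
  (Y_chain : markov_chain init p P Y)
  (model : second_order_channel_model chan P Y m v2)
  (mu_proper : forall S : {set 'I_N},
     S != finset.set0 -> S \proper [set: 'I_N]%SET ->
     \sum_(i in S) mu i < m S)
  (mu_total : \sum_i mu i = m ([set: 'I_N]%SET))
  (sigma_total : Num.sqrt (v2 ([set: 'I_N]%SET)) <= \sum_i Num.sqrt (sigma2 i))
  (mu_ge0 : forall i, 0 <= mu i) (sigma2_gt0 : forall i, 0 < sigma2 i) :
  in_capacity_region init p chan mu sigma2.
Proof.
pose c i : R := Num.sqrt (sigma2 i).
have c_gt0 i : 0 < c i by rewrite sqrtr_gt0.
exists (deficit_policy mu c); split; first exact: deficit_policy_is_policy.
pose A := decision chan Y mu c.
exists d, T, P, Y, A; split; first exact: decision_runs.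
move=> i; have N_gt0 : (0 < N)%N := leq_ltn_trans (leq0n i) (ltn_ord i).
have [delta delta0 slack] := uniform_slack mu_proper.
have half0 : 0 < delta / 2 by rewrite divr_gt0.
have [K K0 HK] := near_block_length init_pmf p_stochastic p_irreducible Y_chain
  (fun S => (model S).1) half0.
have [C HC] : exists C, forall n, path_ev init p n
    (fun h => lyapunov mu c (map chan h) ^+ 2) [::] <= C * n.+1%:R.
  apply: (path_ev_sqr_lyapunov_linear c_gt0 N_gt0 init_pmf p_stochastic delta0 K0).
    (* Of the slack [2 * delta], the averaging error takes [delta / 2], which leaves more than the
       [delta] required. *)
    move=> x S S0 Sp; have := HK x S; rewrite ler_norml => /andP[HS _].
    have := ler_wpM2l (ler0n R K) (slack S S0 Sp).
    have : 0 <= K%:R * delta by rewrite mulr_ge0 // ltW.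
    by lra.
  by move=> x; rewrite mu_total; exact: HK.
have W_gt0 := total_weight_gt0 c_gt0 N_gt0.
pose s n w := channels chan Y n w.
pose a := c i / total_weight c.
have a_gt0 : 0 < a by rewrite divr_gt0.
(* Deliveries are the target, minus a negligible part off the ray spanned by [c], plus the share [a]
   of the common channel fluctuation. *)
have deliveredE n w : \sum_(t < n) (delivery A i t w)%:R =
    n%:R * mu i - c i * imbalance mu c (s n w) i +
    a * (\sum_(t < n) (chan_max [set: 'I_N]%SET (chan (Y t w)))%:R -
      n%:R * m [set: 'I_N]%SET).
  rewrite sum_deliveries (path_deficitE _ _ (c_gt0 i)).
  by rewrite (sum_chan_max chan Y mu c) mu_total -/(s n w) -/a; ring.
have [full_mean [L [L_cvg L_moment]]] := model [set: 'I_N]%SET.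
split.
  move: (imbalance_negligible_ae init_pmf p_stochastic Y_chain c_gt0 HC i) full_mean.
  rewrite /has_mean; apply: filterS2 => w u_cvg X_cvg.
  pose X n : R := (\sum_(t < n) (chan_max [set: 'I_N]%SET (chan (Y t w)))%:R) / n%:R.
  have : ((mu i - c i * (imbalance mu c (s n w) i / n%:R) +
      a * (X n - m [set: 'I_N]%SET))%R @[n --> \oo] -->
      (mu i - c i * 0 + a * (m [set: 'I_N]%SET - m [set: 'I_N]%SET))%R)%classic.
    apply: cvgD; first by apply: cvgB; [exact: cvg_cst | exact: cvgMr].
    by apply: cvgMr; apply: cvgB => //; exact: cvg_cst.
  rewrite mulr0 subr0 subrr mulr0 addr0; apply: cvg_trans; apply: near_eq_cvg.
  near=> n; have n0 : n%:R != 0 :> R by rewrite pnatr_eq0 -lt0n; near: n; exact: nbhs_infty_gt.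
  by rewrite deliveredE /X; field.
exists ((a ^+ 2)%:E * (v2 [set: 'I_N]%SET)%:E)%E; last first.
  rewrite -EFinM lee_fin.
  have v0 : 0 <= v2 [set: 'I_N]%SET.
    rewrite -lee_fin -L_moment; apply: integral_ge0 => x _.
    by rewrite lee_fin sqr_ge0.
  (* After cancelling [a ^+ 2], the claim is the square of [sigma_total], since [total_weight c] is
     the sum of the roots of [sigma2]. *)
  have -> : sigma2 i = a ^+ 2 * total_weight c ^+ 2.
    by rewrite /a exprMn exprVn divfK ?sqr_sqrtr ?expf_neq0 ?gt_eqF // ltW.
  rewrite ler_wpM2l ?sqr_ge0 // -(sqr_sqrtr v0).
  by rewrite lerXn2r ?nnegrE ?sqrtr_ge0 // ltW.
exists (scaled_law L a); split; last by rewrite scaled_law_second_moment L_moment.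
pose U t w := chan_max [set: 'I_N]%SET (chan (Y t w)).
pose e n w := - (c i * imbalance mu c (s n w) i) / Num.sqrt n%:R.
have devE n w : scaled_deviation (delivery A i) (mu i) n w =
    a * scaled_deviation U (m [set: 'I_N]%SET) n w + e n w.
  by rewrite /scaled_deviation deliveredE /e /U; ring.
have U_traj n w : scaled_deviation U (m [set: 'I_N]%SET) n w =
    - total_deficit mu c (map chan (traj Y n w)) / Num.sqrt n%:R.
  by rewrite /scaled_deviation /U (sum_chan_max chan Y mu c) mu_total /channels; ring.
pose e_path n h := - (c i * imbalance mu c (map chan h) i) / Num.sqrt n%:R.
apply: (@cvg_in_law_scale_perturb _ _ _ P (scaled_deviation U (m [set: 'I_N]%SET)) _ e a L).
- exact: a_gt0.
- exact: devE.
- move=> n x.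
  under eq_set do rewrite U_traj.
  exact: measurable_traj Y_chain n
    (fun h => - total_deficit mu c (map chan h) / Num.sqrt n%:R <= x).
- move=> n x.
  under eq_set do rewrite devE U_traj.
  exact: measurable_traj Y_chain n
    (fun h => a * (- total_deficit mu c (map chan h) / Num.sqrt n%:R) + e_path n h <= x).
- move=> n x; exact: measurable_traj Y_chain n (fun h => x <= `|e_path n h|).
- move=> eta eta0.
  exact: (imbalance_negligible_in_probability init_pmf p_stochastic Y_chain c_gt0 HC).
- exact: L_cvg.
Unshelve. all: by end_near. Qed.
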